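(* Let $X\in\mathbb{R}^n$ and $Y=GX+\epsilon\in\mathbb{R}^m$, where $G\in\mathbb{R}^{m\times n}$, $X\sim\mathcal{N}(0,\Gamma_X)$ and $\epsilon\sim\mathcal{N}(0,\Gamma_{Y|X})$ are independent and $\Gamma_X,\Gamma_{Y|X}$ are positive definite; let $\Gamma_Y=G\Gamma_XG^\top+\Gamma_{Y|X}$. Let $\mathcal{P}\in\mathbb{R}^{m\times k}$ be a selection operator and $Y_{\mathcal{P}}=\mathcal{P}^\top Y=[Y_{i_1},\dots,Y_{i_k}]^\top$. Then the mutual information between $X$ and $Y_{\mathcal{P}}$ is bounded by $$\mathcal{I}(X;Y_{\mathcal{P}})\ \ge\ \tfrac12\,\mathrm{trace}\left(\mathcal{P}^\top\left(\log(\Gamma_Y)-\log\mathrm{diag}(\Gamma_{Y|X})\right)\mathcal{P}\right),$$ $$\mathcal{I}(X;Y_{\mathcal{P}})\ \le\ \tfrac12\,\mathrm{trace}\left(\mathcal{P}^\top\left(\log\mathrm{diag}(\Gamma_Y)-\log(\Gamma_{Y|X})\right)\mathcal{P}\right).$$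
   Context: A selection operator $\mathcal{P}\in\mathbb{R}^{m\times k}$, $k<m$, is a matrix $[e_{i_1},\dots,e_{i_k}]$ whose columns are distinct canonical unit vectors of $\mathbb{R}^m$. For a positive definite matrix, $\log$ is the matrix logarithm; $\mathrm{diag}(A)$ is the diagonal matrix with the same diagonal as $A$. Mutual information is the Kullback--Leibler divergence from the product of marginals to the joint density; here $\mathcal{I}(X;Y_{\mathcal{P}})=\frac12\log\frac{\det(\mathcal{P}^\top\Gamma_Y\mathcal{P})}{\det(\mathcal{P}^\top\Gamma_{Y|X}\mathcal{P})}$. *)

(* Defs.v *)
From HB Require Import structures.
From mathcomp Require Import all_boot all_order all_algebra.
From mathcomp Require Import all_classical all_reals all_analysis.

Set Implicit Arguments.
Unset Strict Implicit.
Unset Printing Implicit Defensive.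

Import Order.TTheory GRing.Theory Num.Theory.
Import numFieldNormedType.Exports.

Local Open Scope classical_set_scope.
Local Open Scope ring_scope.

Section matrices.
Context {R : realType}.

Definition posdefmx n (A : 'M[R]_n) : Prop :=
  A^T = A /\ forall v : 'cV[R]_n, v != 0 -> 0 < (v^T *m A *m v) 0 0.

(* [selection_mx s] is the matrix [e_(s 0), ..., e_(s (k-1))] *)
Definition selection_mx m k (s : 'I_k -> 'I_m) : 'M[R]_(m, k) :=
  \matrix_(i, j) (i == s j)%:R.

Definition is_selection m k (S : 'M[R]_(m, k)) : Prop :=
  (k < m)%N /\ exists2 s : 'I_k -> 'I_m, injective s & S = selection_mx s.

Definition diag_part n (A : 'M[R]_n) : 'M[R]_n := diag_mx (\row_i A i i).

(* The logarithm of a positive definite matrix by functional calculus: it acts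
   as [ln] on the eigenvalues in an orthonormal eigenbasis. *)
Definition is_logm n (A L : 'M[R]_n) : Prop :=
  exists (U : 'M[R]_n) (d : 'rV[R]_n),
    [/\ U *m U^T = 1%:M, forall i, 0 < d 0 i,
        A = U *m diag_mx d *m U^T &
        L = U *m diag_mx (map_mx (@ln R) d) *m U^T].

Lemma is_logm_unique n (A L1 L2 : 'M[R]_n) :
  is_logm A L1 -> is_logm A L2 -> L1 = L2.
Proof.
move=> [U [d [UU d0 AU ->]]] [V [e [VV e0 AV ->]]].
have UU' : U^T *m U = 1%:M by exact: mulmx1C.
have VV' : V^T *m V = 1%:M by exact: mulmx1C.
have [W defW] : exists W, W = V^T *m U by exists (V^T *m U).
have WW : W *m W^T = 1%:M.
  by rewrite defW trmx_mul trmxK mulmxA -(mulmxA V^T) UU mulmx1.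
have W1 : W *m diag_mx d = diag_mx e *m W.
  have : V^T *m (U *m diag_mx d *m U^T) *m U =
         V^T *m (V *m diag_mx e *m V^T) *m U by rewrite -AU -AV.
  by rewrite !mulmxA VV' mul1mx -!mulmxA UU' mulmx1 -defW mulmxA -defW.
have W2 : W *m diag_mx (map_mx (@ln R) d) = diag_mx (map_mx (@ln R) e) *m W.
  apply/matrixP => i j; move/matrixP: W1 => /(_ i j).
  rewrite !mul_mx_diag !mul_diag_mx !mxE.
  have [->|wij] := eqVneq (W i j) 0; first by rewrite !mul0r !mulr0.
  by rewrite [RHS]mulrC => /(mulfI wij) ->; rewrite mulrC.
have -> : U = V *m W by rewrite defW mulmxA VV mul1mx.
by rewrite trmx_mul -(mulmxA V W) W2 !mulmxA -(mulmxA _ W W^T) WW mulmx1.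
Qed.

(* The default value 0 is only taken when [A] is not positive definite. *)
Definition logm n (A : 'M[R]_n) : 'M[R]_n := xget 0 [set L | is_logm A L].

End matrices.

Section lebesgue_tuple.
Context {R : realType}.

Definition tuple_cons n (p : measurableTypeR R * n.-tuple R) : n.+1.-tuple R :=
  [the n.+1.-tuple R of p.1 :: p.2].

Definition tuple_uncons n (t : n.+1.-tuple R) : measurableTypeR R * n.-tuple R :=
  (thead t, [tuple of behead t]).

Lemma measurable_tuple_cons n : measurable_fun setT (@tuple_cons n).
Proof. exact: measurable_cons. Qed.

Lemma measurable_tuple_uncons n : measurable_fun setT (@tuple_uncons n).
Proof.
apply: measurable_fun_pair; last exact: measurable_behead.
exact: measurable_tnth.
Qed.

Section cons_measure.
Variables (n : nat) (mu : {sigma_finite_measure set (n.-tuple R) -> \bar R}).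

Definition cons_measure : set (n.+1.-tuple R) -> \bar R :=
  pushforward (lebesgue_measure \x mu)%E (@tuple_cons n).

Let mcons (A : set (n.+1.-tuple R)) :
  measurable A -> measurable (@tuple_cons n @^-1` A).
Proof.
by move=> mA; rewrite -[X in measurable X]setTI; exact: measurable_tuple_cons.
Qed.

Let cons_measure0 : cons_measure set0 = 0%E.
Proof. by rewrite /cons_measure /pushforward preimage_set0 measure0. Qed.

Let cons_measure_ge0 A : (0 <= cons_measure A)%E.
Proof. by rewrite /cons_measure /pushforward; apply: measure_ge0. Qed.

Let cons_measure_sigma_additive : semi_sigma_additive cons_measure.
Proof.
move=> F mF tF mUF; rewrite /cons_measure /pushforward preimage_bigcup.
apply: measure_semi_sigma_additive.
- by move=> k; exact: mcons.
- apply/trivIsetP => /= i j _ _ ij; rewrite -preimage_setI.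
  by move/trivIsetP : tF => /(_ _ _ _ _ ij) ->//; rewrite preimage_set0.
- by rewrite -preimage_bigcup; exact: mcons.
Qed.

HB.instance Definition _ := isMeasure.Build _ _ _ cons_measure
  cons_measure0 cons_measure_ge0 cons_measure_sigma_additive.

Let cons_measure_sigma_finite : sigma_finite setT cons_measure.
Proof.
have /sigma_finiteP[G [GT ndG mG]] := sigma_finiteT mu.
have /sigma_finiteP[F [FT ndF mF]] := sigma_finiteT (@lebesgue_measure R).
have tK : cancel (@tuple_cons n) (@tuple_uncons n).
  by move=> [x t]; congr pair; exact/val_inj.
exists (fun k => @tuple_uncons n @^-1` (F k `*` G k)).
  rewrite -preimage_bigcup -(preimage_setT (@tuple_uncons n)).
  congr preimage; rewrite -setXTT FT GT predeqE => -[x y]; split.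
    move=> [/= [i _ Fx] [j _ Gy]]; exists (maxn i j) => //; split.
    - by move: x Fx; exact/subsetPset/ndF/leq_maxl.
    - by move: y Gy; exact/subsetPset/ndG/leq_maxr.
  by move=> [i _ []/= ? ?]; split; exists i.
move=> k; have [mFk Fk] := mF k; have [mGk Gk] := mG k; split.
  rewrite -[X in measurable X]setTI.
  by apply: measurable_tuple_uncons => //; exact: measurableX.
rewrite /cons_measure /pushforward -comp_preimage.
rewrite (_ : _ \o _ = id); last by apply/funext => p; exact: tK.
by rewrite preimage_id product_measure1E// lte_mul_pinfty// ge0_fin_numE.
Qed.

HB.instance Definition _ := Measure_isSigmaFinite.Build _ _ _ cons_measure
  cons_measure_sigma_finite.

End cons_measure.

(* Lebesgue measure on R^n, R^n being [n.-tuple R] with its product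
   sigma-algebra; see [lebesgue_tuple_box]. *)
Fixpoint lebesgue_tuple n : {sigma_finite_measure set (n.-tuple R) -> \bar R} :=
  match n with
  | 0 => \d_ [tuple]
  | n'.+1 => cons_measure (lebesgue_tuple n')
  end.

Lemma lebesgue_tuple_box n (A : 'I_n -> set R) :
  (forall i, measurable (A i)) ->
  lebesgue_tuple n [set t | forall i, A i (tnth t i)] =
  (\prod_(i < n) lebesgue_measure (A i))%E.
Proof.
elim: n A => [|n IHn] A mA /=.
  by rewrite big_ord0 diracE mem_set// => -[].
rewrite big_ord_recl -IHn; last by move=> i.
rewrite -product_measure1E//; [|exact: mA|]; last first.
  rewrite (_ : [set _ | _] =
      \bigcap_(i in [set: 'I_n]) ((fun t => tnth t i) @^-1` A (lift ord0 i))).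
    apply: fin_bigcap_measurable => // i _.
    by rewrite -[X in measurable X]setTI; exact: measurable_tnth.
  by apply/seteqP; split => t /= tA i; [move=> _|]; exact: tA.
rewrite /cons_measure /pushforward; congr ((_ \x _)%E _).
apply/seteqP; split => -[x t] /=.
  move=> xt; split; first by have := xt ord0; rewrite tnth0.
  by move=> i; have := xt (lift ord0 i); rewrite tnthS.
move=> [xA tA] i; case: (unliftP ord0 i) => [j ->|->]; last first.
  by rewrite tnth0.
by rewrite tnthS; exact: tA.
Qed.

End lebesgue_tuple.

Section random_vectors.
Context {R : realType}.

Definition colv n (t : n.-tuple R) : 'cV[R]_n := \col_i tnth t i.

(* density of N(mu, Gamma) for a positive definite [Gamma] *)
Definition normal_vec_pdf n (mu : 'cV[R]_n) (Gamma : 'M[R]_n) (x : 'cV[R]_n) :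
    R :=
  (Num.sqrt ((2 * pi) ^+ n * \det Gamma))^-1 *
  expR (- (((x - mu)^T *m invmx Gamma *m (x - mu)) 0 0) / 2).

Context d (T : measurableType d) (P : probability T R).

Definition normal_vec n (X : {RV P >-> n.-tuple R}) (mu : 'cV[R]_n)
    (Gamma : 'M[R]_n) : Prop :=
  forall A : set (n.-tuple R), measurable A ->
    distribution P X A =
    (\int[lebesgue_tuple n]_(t in A) (normal_vec_pdf mu Gamma (colv t))%:E)%E.

Context d1 d2 (T1 : measurableType d1) (T2 : measurableType d2).

Definition independent_RV (X : {RV P >-> T1}) (Y : {RV P >-> T2}) : Prop :=
  forall A B, measurable A -> measurable B ->
    P (X @^-1` A `&` Y @^-1` B) = (P (X @^-1` A) * P (Y @^-1` B))%E.

Definition pair_RV (X : {RV P >-> T1}) (Y : {RV P >-> T2}) : T -> T1 * T2 :=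
  fun w => (X w, Y w).

Lemma measurable_pair_RV (X : {RV P >-> T1}) (Y : {RV P >-> T2}) :
  measurable_fun setT (pair_RV X Y).
Proof. exact: measurable_fun_pair. Qed.

HB.instance Definition _ (X : {RV P >-> T1}) (Y : {RV P >-> T2}) :=
  isMeasurableFun.Build _ _ _ _ (pair_RV X Y) (measurable_pair_RV X Y).

End random_vectors.

Section mutual_information.
Context {R : realType}.
Local Open Scope ereal_scope.
Local Open Scope charge_scope.

(* D(nu || mu), the integral of log (d nu / d mu) with respect to [nu] *)
Definition KL_divergence d (T : measurableType d) (nu mu : probability T R) :
    \bar R :=
  if `[< nu `<< mu >] then
    \int[nu]_x lne (('d (charge_of_finite_measure nu) '/d mu) x)
  else +oo.

(* divergence of the joint law from the product of the marginal laws *)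
Definition mutual_information d (T : measurableType d) (P : probability T R)
    d1 d2 (T1 : measurableType d1) (T2 : measurableType d2)
    (X : {RV P >-> T1}) (Y : {RV P >-> T2}) : \bar R :=
  KL_divergence (distribution P (pair_RV X Y))
                (distribution P X \x distribution P Y).

End mutual_information.

(* Main.v *)
Require Import Defs.
From HB Require Import structures.
From mathcomp Require Import all_boot all_order all_algebra.
From mathcomp Require Import all_classical all_reals all_analysis.
From mathcomp Require Import fingroup perm measurable_realfun ring lra.
From mathcomp Require spectral complex.
Import (canonicals, coercions) complex spectral.

Set Implicit Arguments.
Unset Strict Implicit.
Unset Printing Implicit Defensive.

Import Order.TTheory GRing.Theory Num.Theory.
Import numFieldNormedType.Exports.

Local Open Scope classical_set_scope.
Local Open Scope ring_scope.

(** The mutual information is computed exactly and then bounded by linear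
    algebra. Write S for the selection matrix, H = S^T G,
    B = S^T GammaYX S and C = S^T GammaY S = H GammaX H^T + B.

    The observation is YS = H X + S^T eps, where S^T eps has law N(0, B) and is
    independent of X. Hence (X, YS) has density f_X(x) f_B(y - H x), YS has
    density f_C(y), and the likelihood ratio of the joint law with respect to
    the product of its marginals is f_B(y - H x) / f_C(y). Its logarithm is
    half of (ln det C - ln det B) plus half the difference of the squared
    Mahalanobis norms of YS for C and of S^T eps for B. Both norms are
    chi-squared with k degrees of freedom, so their means cancel
    ([half_moment_eq]) and
      I(X; YS) = (ln det C - ln det B) / 2   ([mutual_information_gaussian]).

    For a positive definite A, both bounds follow from
      tr (S^T log A S) <= ln det (S^T A S) <= tr (S^T log (diag A) S),
    used for A = GammaY and for A = GammaYX. The left inequality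
    ([mxtrace_logm_compress_le]) is Jensen's inequality for the concave
    function ln in an eigenbasis of A, applied at each eigenvector of the
    compression S^T A S; the right one is Hadamard's inequality for S^T A S
    ([hadamard]), the same Jensen inequality at the canonical basis.

    The Gaussian computations rest on two identities between densities. A
    change of variables of determinant 1 or -1 carries f_D to f_{K D K^T}
    ([gauss_pdf_linear]), and Gaussian elimination on the covariance therefore
    factors a Gaussian density into a conditional and a marginal one
    ([gauss_pdf_schur]). With translation invariance and Tonelli, the latter
    gives the total mass, by induction on the dimension, and all marginals. *)

(** * Quadratic forms and the real spectral theorem *)

Section positive_definite.
Context {R : realType}.

Definition quad n (A : 'M[R]_n) (v : 'cV[R]_n) : R := (v^T *m A *m v) 0 0.

Lemma quad_mulmx m n (A : 'M[R]_m) (W : 'M[R]_(m, n)) v :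
  quad A (W *m v) = quad (W^T *m A *m W) v.
Proof. by rewrite /quad trmx_mul !mulmxA. Qed.

Lemma quadZ n (A : 'M[R]_n) a v : quad A (a *: v) = a ^+ 2 * quad A v.
Proof.
rewrite /quad (_ : (a *: v)^T = a *: v^T); last first.
  by apply/matrixP => i j; rewrite !mxE.
by rewrite -!scalemxAl -scalemxAr scalerA mxE expr2.
Qed.

Lemma quad_diag n (d : 'rV[R]_n) v :
  quad (diag_mx d) v = \sum_i (v i 0) ^+ 2 * d 0 i.
Proof.
rewrite /quad mul_mx_diag mxE; apply: eq_bigr => i _.
by rewrite !mxE mulrAC -expr2.
Qed.

Lemma quad1 n (v : 'cV[R]_n) : quad 1%:M v = \sum_i (v i 0) ^+ 2.
Proof.
rewrite /quad mulmx1 mxE; apply: eq_bigr => i _.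
by rewrite !mxE -expr2.
Qed.

Lemma quad1_gt0 n (v : 'cV[R]_n) : v != 0 -> 0 < quad 1%:M v.
Proof.
move=> v0; rewrite quad1 lt_def sumr_ge0 ?andbT; last by move=> i _; exact: sqr_ge0.
apply: contraNneq v0 => /psumr_eq0P v0; apply/eqP/colP => i; rewrite mxE.
by apply/eqP; rewrite -sqrf_eq0; apply/eqP/v0 => // j _; exact: sqr_ge0.
Qed.

Lemma quad_delta n (A : 'M[R]_n) i : quad A (delta_mx i 0) = A i i.
Proof. by rewrite /quad trmx_delta -rowE -colE !mxE. Qed.

Lemma posdefmx_congr m n (A : 'M[R]_m) (W : 'M[R]_(m, n)) :
  posdefmx A -> (forall v : 'cV_n, W *m v = 0 -> v = 0) ->
  posdefmx (W^T *m A *m W).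
Proof.
move=> [Asym Apos] Winj; split; first by rewrite !trmx_mul trmxK Asym mulmxA.
move=> v v0; rewrite -/(quad _ _) -quad_mulmx; apply: Apos.
by apply: contraNneq v0 => /Winj ->.
Qed.

(** A complex diagonalization of the symmetric matrix has real eigenvalues, and
    a real root of the complex characteristic polynomial is a root of the real
    one. *)
Lemma sym_has_eigenvalue n (A : 'M[R]_n.+1) :
  A^T = A -> exists a, eigenvalue A a.
Proof.
move=> Asym.
pose C : numClosedFieldType := complex.complex R.
pose toC : {rmorphism R -> C} := complex.real_complex_def (Phant R).
pose Ac := map_mx toC A.
have [lam rlam Elam] : exists2 l, l \is Num.real & eigenvalue Ac l.
  have Anorm : Ac \is hermitianmx n.+1 false Num.conj.
    apply: spectral.realsym_hermsym.
    - apply/sesquilinear.is_hermitianmxP; rewrite expr0 scale1r.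
      by rewrite map_mx_id// /Ac map_trmx Asym.
    - by apply/mxOverP => i j; rewrite mxE complex.complex_real.
  have := spectral.hermitian_spectral_diag_real Anorm.
  have /spectral.hermitian_normalmx/spectral.orthomx_spectralP := Anorm.
  set Q := spectral.spectralmx Ac; set sp := spectral.spectral_diag Ac => AQ.
  move=> /mxOverP/(_ 0 0) spreal; exists (sp 0 0) => //.
  have QU : Q \in unitmx by exact: spectral.spectral_unit.
  apply/eigenvalueP; exists (row 0 Q).
    rewrite -row_mul {1}AQ mulmxA mulmxA mulmxV// mul1mx.
    by apply/rowP => j; rewrite mxE mul_diag_mx !mxE.
  apply: contraTneq QU => Q0; rewrite -row_free_unit.
  apply/negP => /row_freeP[B QB].
  have := congr1 (fun M => row 0 M) QB; rewrite row_mul Q0 mul0mx.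
  move/rowP => /(_ 0); rewrite !mxE eqxx => /eqP.
  by rewrite eq_sym oner_eq0.
have [a lama] : exists a, lam = toC a.
  by case/complex.complex_realP: rlam => a ->; exists a.
exists a; move: Elam; rewrite lama !eigenvalue_root_char -map_char_poly.
by rewrite fmorph_root.
Qed.

(** The reflection in the hyperplane orthogonal to [v - e], or the identity when
    [v = e]. *)
Lemma householder n (v e : 'cV[R]_n) : quad 1%:M v = quad 1%:M e ->
  exists H : 'M[R]_n, [/\ H^T = H, H *m H = 1%:M & H *m e = v].
Proof.
move=> ve; have [->|nve] := eqVneq v e.
  by exists 1%:M; rewrite trmx1 !mul1mx.
pose w := v - e; pose q := quad 1%:M w.
have w0 : w != 0 by rewrite subr_eq0.
have q0 : q != 0 by rewrite gt_eqF// quad1_gt0.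
have ww : w^T *m w = q%:M by rewrite [LHS]mx11_scalar /q /quad mulmx1.
have we : w^T *m e = (- (q / 2))%:M.
  rewrite [LHS]mx11_scalar; congr (_%:M).
  have C : (e^T *m v) 0 0 = (v^T *m e) 0 0.
    by rewrite -[e^T *m v]trmxK trmx_mul trmxK mxE.
  move: ve; rewrite /q /quad /w !mulmx1 linearB/= !mulmxBl !mulmxBr !mxE.
  move: C; rewrite !mxE; lra.
exists (1%:M - (2 / q) *: (w *m w^T)); split.
- by rewrite linearB/= trmx1 linearZ/= trmx_mul trmxK.
- set X := (2 / q) *: (w *m w^T).
  have XX : X *m X = X + X.
    rewrite /X -scalemxAl -scalemxAr scalerA mulmxA -(mulmxA w) ww.
    rewrite mul_mx_scalar -scalemxAl scalerA -scalerDl; congr (_ *: _).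
    by field.
  rewrite mulmxBr mulmx1 mulmxBl mul1mx XX.
  by apply/matrixP => i j; rewrite !mxE; ring.
- rewrite mulmxBl mul1mx -scalemxAl -mulmxA we mul_mx_scalar scalerA.
  rewrite (_ : 2 / q * - (q / 2) = -1) ?scaleN1r ?opprK ?subrK 1?addrC ?subrK//.
  by field.
Qed.

(** Deflation: a reflection that maps the first basis vector to a unit
    eigenvector splits off a block of size 1. *)
Lemma sym_spectral n (A : 'M[R]_n) : A^T = A ->
  exists (U : 'M[R]_n) (d : 'rV[R]_n),
    U *m U^T = 1%:M /\ A = U *m diag_mx d *m U^T.
Proof.
elim: n A => [|n IHn] A Asym.
  by exists 1%:M, 0; split; apply/matrixP => -[].
have [a /eigenvalueP[u uA u0]] := sym_has_eigenvalue Asym.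
have [v Av v1] : exists2 v : 'cV[R]_n.+1, A *m v = a *: v & quad 1%:M v = 1.
  have uT0 : u^T != 0 by rewrite trmx_eq0.
  have q0 := quad1_gt0 uT0.
  exists ((Num.sqrt (quad 1%:M u^T))^-1 *: u^T).
    by rewrite -scalemxAr -{1}Asym -trmx_mul uA linearZ/= !scalerA mulrC.
  by rewrite quadZ exprVn sqr_sqrtr ?ltW// mulVf// gt_eqF.
pose e : 'cV[R]_n.+1 := delta_mx 0 0.
have [H [Hsym HH He]] : exists H : 'M[R]_n.+1,
    [/\ H^T = H, H *m H = 1%:M & H *m e = v].
  by apply: householder; rewrite v1 quad_delta mxE eqxx.
have [A' defA'] : exists A' : 'M[R]_(1 + n), A' = H *m A *m H.
  by exists (H *m A *m H).
have A'sym : A'^T = A' by rewrite defA' !trmx_mul Hsym Asym mulmxA.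
have A'e : A' *m e = a *: e.
  by rewrite defA' -!mulmxA He Av -scalemxAr -He mulmxA HH mul1mx.
have A'l i : A' i (lshift n 0) = a * (i == lshift n 0)%:R.
  have -> : lshift n 0 = 0 :> 'I_(1 + n) by exact/val_inj.
  by have /colP/(_ i) := A'e; rewrite -colE !mxE eqxx andbT.
have A'E : A' = block_mx a%:M 0 0 (drsubmx A').
  rewrite -[LHS]submxK; congr block_mx; apply/matrixP => i j.
  - by rewrite !ord1 !mxE A'l !eqxx mulr1.
  - by rewrite ord1 -A'sym !mxE A'l eq_rlshift mulr0.
  - by rewrite ord1 !mxE A'l eq_rlshift mulr0.
have [|U' [d' [UU' A'U']]] := IHn (drsubmx A').
  by rewrite trmx_drsub A'sym.
pose D : 'M[R]_(1 + n) := block_mx 1%:M 0 0 U'.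
have DD : D *m D^T = 1%:M.
  rewrite /D tr_block_mx mulmx_block.
  rewrite !trmx1 !trmx0 !mulmx0 !mul0mx !addr0 !add0r mulmx1 UU'.
  by rewrite -scalar_mx_block.
have DA' : D *m diag_mx (row_mx a%:M d') *m D^T = A'.
  rewrite A'E A'U' /D tr_block_mx diag_mx_row !mulmx_block.
  rewrite trmx1 !trmx0 !(mulmx0, mul0mx, addr0, add0r, mulmx1, mul1mx).
  by congr block_mx; rewrite [LHS]mx11_scalar !mxE eqxx.
exists (H *m D), (row_mx a%:M d'); split.
  by rewrite trmx_mul Hsym mulmxA -(mulmxA H D) DD mulmx1.
rewrite trmx_mul Hsym !mulmxA -(mulmxA H D) -(mulmxA H _ D^T) DA' defA'.
by rewrite !mulmxA HH mul1mx -mulmxA HH mulmx1.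
Qed.

Lemma posdefmx_spectral n (A : 'M[R]_n) : posdefmx A ->
  exists (U : 'M[R]_n) (d : 'rV[R]_n),
    [/\ U *m U^T = 1%:M, forall i, 0 < d 0 i & A = U *m diag_mx d *m U^T].
Proof.
move=> [Asym Apos]; have [U [d [UU AE]]] := sym_spectral Asym.
exists U, d; split => // i; have U'U := mulmx1C UU.
have := Apos (U *m delta_mx i 0).
rewrite -/(quad _ _) quad_mulmx AE !mulmxA U'U mul1mx -mulmxA U'U mulmx1.
rewrite quad_delta mxE eqxx mulr1n; apply.
apply/eqP => /(congr1 (mulmx U^T)); rewrite mulmx0 mulmxA U'U mul1mx.
by move=> /colP/(_ i)/eqP; rewrite !mxE !eqxx oner_eq0.
Qed.

(** Spectral decompositions exist, so the default value of [logm] is not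
    taken. *)
Lemma logmP n (A : 'M[R]_n) : posdefmx A -> is_logm A (logm A).
Proof.
move=> /posdefmx_spectral[U [d [UU d0 AE]]]; rewrite /logm.
case: xgetP => [L _ //|/(_ (U *m diag_mx (map_mx (@ln R) d) *m U^T))/=[]].
by exists U, d; split.
Qed.

Lemma is_logmE n (A L : 'M[R]_n) : is_logm A L -> logm A = L.
Proof.
move=> AL; apply: is_logm_unique (AL); rewrite /logm.
by case: xgetP => [//|/(_ L)/=[]].
Qed.

Lemma logm_diag n (d : 'rV[R]_n) : (forall i, 0 < d 0 i) ->
  logm (diag_mx d) = diag_mx (map_mx (@ln R) d).
Proof.
move=> d0; apply: is_logmE; exists 1%:M, d.
by rewrite !trmx1 !mulmx1 !mul1mx; split.
Qed.

Lemma det_orthogonal_conj n (U A : 'M[R]_n) :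
  U *m U^T = 1%:M -> \det (U *m A *m U^T) = \det A.
Proof.
by move=> UU; rewrite !det_mulmx mulrAC -det_mulmx UU det1 mul1r.
Qed.

Lemma tr_orthogonal_conj n (U A : 'M[R]_n) :
  U *m U^T = 1%:M -> \tr (U *m A *m U^T) = \tr A.
Proof. by move=> /mulmx1C UU; rewrite mxtrace_mulC mulmxA UU mul1mx. Qed.

Lemma posdefmx_det_gt0 n (A : 'M[R]_n) : posdefmx A -> 0 < \det A.
Proof.
move=> /posdefmx_spectral[U [d [UU d0 ->]]].
by rewrite det_orthogonal_conj// det_diag prodr_gt0.
Qed.

Lemma posdefmx_unit n (A : 'M[R]_n) : posdefmx A -> A \in unitmx.
Proof. by move=> /posdefmx_det_gt0 A0; rewrite unitmxE unitfE gt_eqF. Qed.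

Lemma posdefmx_inv n (A : 'M[R]_n) : posdefmx A -> posdefmx (invmx A).
Proof.
move=> Apos; have Au := posdefmx_unit Apos; have [Asym _] := Apos.
have -> : invmx A = (invmx A)^T *m A *m invmx A.
  by rewrite -mulmxA mulmxV// mulmx1 trmx_inv Asym.
apply: posdefmx_congr => // v /(congr1 (mulmx A)).
by rewrite mulmxA mulmxV// mul1mx mulmx0.
Qed.

(** * Trace of the logarithm and logarithm of the determinant *)

(** ln lies below its tangent at the barycentre; averaging the tangent bounds
    gives the claim. *)
Lemma ln_jensen n (w d : 'I_n -> R) : (forall i, 0 <= w i) ->
  \sum_i w i = 1 -> (forall i, 0 < d i) ->
  \sum_i w i * ln (d i) <= ln (\sum_i w i * d i).
Proof.
move=> w0 w1 d0; set s := \sum_i w i * d i.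
have s0 : 0 < s.
  rewrite lt_def sumr_ge0 ?andbT; last by move=> i _; rewrite mulr_ge0// ltW.
  have wd0 i : true -> 0 <= w i * d i by move=> _; rewrite mulr_ge0// ltW.
  apply/negP => /eqP/(psumr_eq0P wd0) wd.
  have : \sum_i w i = 0.
    apply: big1 => i _; apply/eqP; have /eqP := wd i isT.
    by rewrite mulf_eq0 (gt_eqF (d0 i)) orbF.
  by rewrite w1 => /eqP; rewrite oner_eq0.
have tangent i : ln (d i) <= ln s + (d i / s - 1).
  have ds0 : 0 < d i / s by rewrite divr_gt0.
  have -> : ln (d i) = ln s + ln (d i / s).
    by rewrite -lnM ?posrE// mulrCA divff ?mulr1// gt_eqF.
  rewrite lerD2l.
  have := @le_ln1Dx R (d i / s - 1); rewrite addrCA subrr addr0; apply.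
  by rewrite ltrBrDr addrC subrr.
apply: (@le_trans _ _ (\sum_i w i * (ln s + (d i / s - 1)))).
  by apply: ler_sum => i _; rewrite ler_wpM2l.
under eq_bigr do rewrite mulrDr mulrBr mulr1 mulrA.
rewrite big_split/= sumrB -!mulr_suml -/s w1 mul1r divff ?gt_eqF//.
by rewrite subrr addr0.
Qed.

(** The squared coordinates of a unit vector in an eigenbasis of [A] are weights
    of total 1: this is Jensen's inequality for the eigenvalues. *)
Lemma quad_logm_le n (A : 'M[R]_n) v : posdefmx A -> quad 1%:M v = 1 ->
  quad (logm A) v <= ln (quad A v).
Proof.
move=> Apos v1; have [U [d [UU d0 AE LE]]] := logmP Apos.
have quadU (b : 'rV[R]_n) :
    quad (U *m diag_mx b *m U^T) v = \sum_i ((U^T *m v) i 0) ^+ 2 * b 0 i.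
  by rewrite -quad_diag quad_mulmx trmxK.
rewrite LE AE !quadU.
under eq_bigr do rewrite [map_mx _ _ _ _]mxE.
apply: ln_jensen => //; first by move=> i; exact: sqr_ge0.
by rewrite -quad1 quad_mulmx trmxK mulmx1 UU.
Qed.

Lemma ln_prod n (d : 'I_n -> R) : (forall i, 0 < d i) ->
  ln (\prod_i d i) = \sum_i ln (d i).
Proof.
elim: n d => [|n IHn] d d0; first by rewrite !big_ord0 ln1.
by rewrite !big_ord_recl lnM ?posrE ?prodr_gt0// IHn.
Qed.

Lemma mxtrace_logm n (A : 'M[R]_n) : posdefmx A ->
  \tr (logm A) = ln (\det A).
Proof.
move=> /logmP[U [d [UU d0 AE ->]]]; rewrite tr_orthogonal_conj// {1}AE.
rewrite det_orthogonal_conj// det_diag mxtrace_diag.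
rewrite ln_prod//.
by apply: eq_bigr => i _; rewrite mxE.
Qed.

(** With [V] an orthonormal eigenbasis of the compression [W^T *m A *m W], the
    unit vectors [W *m v], for [v] a column of [V], have as values of [quad A]
    the eigenvalues of the compression. Summing [quad_logm_le] over them turns
    the left side into a trace and the right side into ln det. *)
Lemma mxtrace_logm_compress_le m k (A : 'M[R]_m) (W : 'M[R]_(m, k)) :
  posdefmx A -> W^T *m W = 1%:M ->
  \tr (W^T *m logm A *m W) <= ln (\det (W^T *m A *m W)).
Proof.
move=> Apos WW.
have Winj (v : 'cV_k) : W *m v = 0 -> v = 0.
  by move=> /(congr1 (mulmx W^T)); rewrite mulmxA WW mul1mx mulmx0.
have [V [e [VV e0 BE]]] := posdefmx_spectral (posdefmx_congr Apos Winj).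
have V'V := mulmx1C VV.
rewrite [in leRHS]BE det_orthogonal_conj// det_diag ln_prod//.
have -> : \tr (W^T *m logm A *m W) =
          \sum_j quad (logm A) (W *m V *m delta_mx j 0).
  rewrite -[LHS](@tr_orthogonal_conj _ V^T) ?trmxK//.
  rewrite /mxtrace; apply: eq_bigr => j _.
  by rewrite -quad_delta !quad_mulmx trmx_mul !mulmxA.
apply: ler_sum => j _.
have -> : e 0 j = quad A (W *m V *m delta_mx j 0).
  rewrite !quad_mulmx trmx_mul !mulmxA -(mulmxA V^T) -(mulmxA V^T) BE.
  rewrite !mulmxA V'V mul1mx -mulmxA V'V mulmx1 quad_delta mxE eqxx.
  by rewrite mulr1n.
apply: quad_logm_le => //; rewrite !quad_mulmx trmx_mul mulmx1.
by rewrite mulmxA -(mulmxA V^T) WW mulmx1 V'V quad_delta mxE eqxx.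
Qed.

(** [quad_logm_le] at the canonical basis, whose sum is the trace of
    [logm A]. *)
Lemma hadamard n (A : 'M[R]_n) : posdefmx A ->
  ln (\det A) <= \sum_i ln (A i i).
Proof.
move=> Apos; rewrite -mxtrace_logm// /mxtrace; apply: ler_sum => i _.
rewrite -!quad_delta; apply: quad_logm_le => //.
by rewrite quad_delta mxE eqxx.
Qed.

End positive_definite.

(** * Lebesgue measure on tuples *)

Section coordinates.
Context {R : realType}.

Definition vtuple n (v : 'cV[R]_n) : n.-tuple R := [tuple v i 0 | i < n].

Lemma colvK n : cancel (@colv R n) (@vtuple n).
Proof. by move=> t; apply: eq_from_tnth => i; rewrite tnth_mktuple mxE. Qed.

Lemma vtupleK n : cancel (@vtuple n) (@colv R n).
Proof. by move=> v; apply/colP => i; rewrite mxE tnth_mktuple. Qed.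

Section measurable_coordinates.
Context d (T : measurableType d).

(** The sigma-algebra is carried by tuples, whereas the algebra takes place on
    column vectors; measurability of the latter is stated coordinatewise. *)
Definition measurable_cv n (g : T -> 'cV[R]_n) :=
  forall i, measurable_fun setT (fun t => g t i 0).

Lemma measurable_vtuple n (g : T -> 'cV[R]_n) :
  measurable_cv g -> measurable_fun setT (fun t => vtuple (g t)).
Proof.
move=> mg; apply/measurable_fun_tnthP => i /=.
rewrite (_ : _ \o _ = fun t => g t i 0)//; apply/funext => t /=.
by rewrite tnth_mktuple.
Qed.

Lemma measurable_colv n (g : T -> n.-tuple R) :
  measurable_fun setT g -> measurable_cv (fun t => colv (g t)).
Proof.
move=> /measurable_fun_tnthP mg i; rewrite (_ : (fun _ => _) = fun t => tnth (g t) i).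
  exact: mg.
by apply/funext => t; rewrite mxE.
Qed.

Lemma measurable_cv_mulmx m n (A : 'M[R]_(m, n)) (g : T -> 'cV[R]_n) :
  measurable_cv g -> measurable_cv (fun t => A *m g t).
Proof.
move=> mg i; rewrite (_ : (fun _ => _) = fun t => \sum_j A i j * g t j 0).
  by apply: measurable_sum => j; apply: measurable_funM => //; exact: mg.
by apply/funext => t; rewrite mxE.
Qed.

Lemma measurable_cvD n (f g : T -> 'cV[R]_n) :
  measurable_cv f -> measurable_cv g -> measurable_cv (fun t => f t + g t).
Proof.
move=> mf mg i; rewrite (_ : (fun _ => _) = fun t => f t i 0 + g t i 0).
  by apply: measurable_funD; [exact: mf|exact: mg].
by apply/funext => t; rewrite mxE.
Qed.

Lemma measurable_cvN n (f : T -> 'cV[R]_n) :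
  measurable_cv f -> measurable_cv (fun t => - f t).
Proof.
move=> mf i; rewrite (_ : (fun _ => _) = fun t => - f t i 0).
  by apply: measurableT_comp => //; exact: mf.
by apply/funext => t; rewrite mxE.
Qed.

Lemma measurable_quad n (A : 'M[R]_n) (g : T -> 'cV[R]_n) :
  measurable_cv g -> measurable_fun setT (fun t => quad A (g t)).
Proof.
move=> mg; rewrite (_ : (fun _ => _) = fun t => \sum_i g t i 0 * (A *m g t) i 0).
  apply: measurable_sum => i; apply: measurable_funM; first exact: mg.
  exact: measurable_cv_mulmx.
apply/funext => t; rewrite /quad -mulmxA mxE.
by apply: eq_bigr => i _; rewrite mxE.
Qed.

Lemma measurable_normal_vec_pdf n (A : 'M[R]_n) (g : T -> 'cV[R]_n) :
  measurable_cv g -> measurable_fun setT (fun t => normal_vec_pdf 0 A (g t)).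
Proof.
move=> mg; apply: measurable_funM => //; apply: measurableT_comp => //.
apply: measurable_funM => //; apply: measurableT_comp => //.
by under eq_fun do rewrite subr0; exact: measurable_quad.
Qed.

End measurable_coordinates.

Lemma measurable_box n (A : 'I_n -> set R) : (forall i, measurable (A i)) ->
  measurable [set t : n.-tuple R | forall i, A i (tnth t i)].
Proof.
move=> mA.
rewrite (_ : [set _ | _] =
    \bigcap_(i in [set: 'I_n]) ((fun t => tnth t i) @^-1` A i)).
  apply: fin_bigcap_measurable => // i _.
  by rewrite -[X in measurable X]setTI; exact: measurable_tnth.
by apply/seteqP; split => t /= tA i; [move=> _|]; exact: tA.
Qed.

(** Boxes are stable by intersection, generate the product sigma-algebra, and
    the cubes [[-k, k]^n] have finite measure and exhaust the space. *)
Lemma lebesgue_tuple_unique n (mu : {measure set (n.-tuple R) -> \bar R}) :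
  (forall A : 'I_n -> set R, (forall i, measurable (A i)) ->
    mu [set t | forall i, A i (tnth t i)] =
    (\prod_(i < n) lebesgue_measure (A i))%E) ->
  forall E, measurable E -> lebesgue_tuple n E = mu E.
Proof.
move=> muE E mE.
pose box (A : 'I_n -> set R) := [set t : n.-tuple R | forall i, A i (tnth t i)].
pose G := [set B | exists2 A, (forall i, measurable (A i)) & B = box A].
apply: (measure_unique G (fun k => box (fun=> `[- k%:R, k%:R]%classic))) => //.
- apply/seteqP; split.
    apply: smallest_sub; first exact: smallest_sigma_algebra.
    rewrite -bigcup_seq => _ [i _ [B mB <-]]; apply: sub_sigma_algebra.
    exists (fun j => if j == i then B else setT).
      by move=> j; case: ifPn.
    rewrite setTI; apply/seteqP; split => t /=.
      by move=> tB j; case: ifPn => // /eqP ->.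
    by move=> /(_ i); rewrite eqxx.
  apply: smallest_sub; first exact: sigma_algebra_measurable.
  by move=> _ [A mA ->]; exact: measurable_box.
- move=> _ _ [A mA ->] [B mB ->]; exists (fun i => A i `&` B i).
    by move=> i; exact: measurableI.
  apply/seteqP; split => t /=; first by move=> [tA tB] i.
  by move=> tAB; split => i; case: (tAB i).
- by move=> k; exists (fun=> `[- k%:R, k%:R]%classic).
- apply/seteqP; split => // t _.
  exists (Num.bound (\sum_i `|tnth t i|)) => // i /=.
  rewrite in_itv/= -ler_norml; apply: (@le_trans _ _ (\sum_i `|tnth t i|)).
    by rewrite (bigD1 i)//= lerDl sumr_ge0.
  by apply: ltW; apply: archi_boundP; exact: sumr_ge0.
- by move=> _ [A mA ->]; rewrite [RHS]muE// -lebesgue_tuple_box.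
- move=> k.
  pose I : set R := `[- k%:R, k%:R]%classic.
  have : (\prod_(i < n) lebesgue_measure I < +oo)%E.
    have -> : lebesgue_measure I = (k%:R + k%:R : R)%:E.
      rewrite /I lebesgue_measure_itv/= lte_fin; case: ifPn.
        by rewrite -EFinD opprK.
      rewrite -leNgt => k0; congr EFin; apply/eqP; rewrite eq_le.
      by have := ler0n R k; lra.
    by rewrite -(big_morph EFin (fun x y => EFinM x y) (erefl 1%E)) ltry.
  by rewrite -(@lebesgue_tuple_box R n (fun=> I))// => i; exact: measurable_itv.
Qed.

Lemma lebesgue_measure_translate (c : R) (A : set R) : measurable A ->
  lebesgue_measure ((fun x => x + c) @^-1` A) = lebesgue_measure A.
Proof.
move=> mA.
have mc : measurable_fun setT (fun x : measurableTypeR R => x + c : measurableTypeR R).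
  exact: measurable_funD.
pose mf : {mfun measurableTypeR R >-> measurableTypeR R} :=
  HB.pack (fun x : R => x + c) (isMeasurableFun.Build _ _ _ _ _ mc).
apply/esym; apply: (@lebesgue_measure_unique R
  (pushforward lebesgue_measure mf)) => // _ [[a b] _ <-].
rewrite /pushforward /=.
transitivity (lebesgue_measure (`]a - c, b - c]%classic : set R)); last first.
  congr (lebesgue_measure _); apply/seteqP; split => x /=.
    by rewrite !in_itv/= ltrBlDr lerBrDr.
  by rewrite !in_itv/= ltrBlDr lerBrDr.
rewrite !lebesgue_measure_itv/= !lte_fin ltrD2r; case: ifPn => // _.
by rewrite -!EFinB opprB addrA subrK.
Qed.

Lemma lebesgue_tuple_translate n (c : 'cV[R]_n) (E : set (n.-tuple R)) :
  measurable E ->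
  lebesgue_tuple n ((fun t => vtuple (colv t + c)) @^-1` E) = lebesgue_tuple n E.
Proof.
move=> mE.
have mc : measurable_fun setT (fun t : n.-tuple R => vtuple (colv t + c)).
  apply: measurable_vtuple; apply: measurable_cvD; first exact: measurable_colv.
  by move=> i; exact: measurable_cst.
pose mf : {mfun n.-tuple R >-> n.-tuple R} :=
  HB.pack (fun t : n.-tuple R => vtuple (colv t + c))
    (isMeasurableFun.Build _ _ _ _ _ mc).
apply/esym; apply: (@lebesgue_tuple_unique n
  (pushforward (lebesgue_tuple n) mf)) => // A mA.
rewrite /pushforward/=.
pose A' i := (fun x => x + c i 0) @^-1` A i.
have mA' i : measurable (A' i).
  rewrite -[A' i]setTI; apply: (_ : measurable_fun setT (fun x : R => x + c i 0)) => //.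
  exact: measurable_funD.
transitivity (\prod_(i < n) lebesgue_measure (A' i))%E; last first.
  by apply: eq_bigr => i _; rewrite lebesgue_measure_translate.
rewrite -lebesgue_tuple_box//; congr (lebesgue_tuple n _).
apply/seteqP; split => t /= tA i; have := tA i.
  by rewrite tnth_mktuple !mxE.
by rewrite /A'/= tnth_mktuple !mxE.
Qed.


Lemma integral_translate n (c : 'cV[R]_n) (f : n.-tuple R -> \bar R) :
  measurable_fun setT f -> (forall t, 0 <= f t)%E ->
  (\int[lebesgue_tuple n]_t f (vtuple (colv t + c)) =
   \int[lebesgue_tuple n]_t f t)%E.
Proof.
move=> mf f0.
have mc : measurable_fun setT (fun t : n.-tuple R => vtuple (colv t + c)).
  apply: measurable_vtuple; apply: measurable_cvD; first exact: measurable_colv.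
  by move=> i; exact: measurable_cst.
rewrite -[LHS](ge0_integral_pushforward mc (lebesgue_tuple n) measurableT mf)//.
apply: eq_measure_integral => A mA _.
exact: lebesgue_tuple_translate.
Qed.

(** The coordinate [i] of the result is the coordinate [s i] of the
    concatenation: an isomorphism of R^r x R^k with R^(r + k) that places the
    second factor on an arbitrary set of [k] coordinates. *)
Definition tuple_glue r k (s : 'S_(r + k)) (p : r.-tuple R * k.-tuple R) :
  (r + k).-tuple R := vtuple (row_perm s (col_mx (colv p.1) (colv p.2))).

Lemma measurable_col_mx d (T : measurableType d) r k
    (f : T -> 'cV[R]_r) (g : T -> 'cV[R]_k) :
  measurable_cv f -> measurable_cv g -> measurable_cv (fun t => col_mx (f t) (g t)).
Proof.
move=> mf mg i; rewrite -(fintype.splitK i); case: (fintype.split i) => j /=.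
  by under eq_fun do rewrite col_mxEu; exact: mf.
by under eq_fun do rewrite col_mxEd; exact: mg.
Qed.

Lemma measurable_tuple_glue r k (s : 'S_(r + k)) : measurable_fun setT (tuple_glue s).
Proof.
apply: measurable_vtuple => i; under eq_fun do rewrite mxE.
by apply: measurable_col_mx; apply: measurable_colv.
Qed.

Lemma lebesgue_tuple_glue r k (s : 'S_(r + k)) (E : set ((r + k).-tuple R)) :
  measurable E ->
  lebesgue_tuple (r + k) E =
  (lebesgue_tuple r \x lebesgue_tuple k)%E (tuple_glue s @^-1` E).
Proof.
move=> mE.
pose mf : {mfun _ >-> _} :=
  HB.pack (tuple_glue s) (isMeasurableFun.Build _ _ _ _ _ (measurable_tuple_glue s)).
apply: (@lebesgue_tuple_unique _
  (pushforward (lebesgue_tuple r \x lebesgue_tuple k)%E mf)) => // A mA.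
rewrite /pushforward/=.
pose A1 a := A (s^-1%g (lshift k a)); pose A2 b := A (s^-1%g (rshift r b)).
transitivity ((lebesgue_tuple r \x lebesgue_tuple k)%E
   ([set t : r.-tuple R | forall i, A1 i (tnth t i)] `*`
    [set t : k.-tuple R | forall i, A2 i (tnth t i)])).
  congr ((_ \x _)%E _); apply/seteqP; split => -[x y] /=.
    move=> xyA; split=> i.
      have := xyA (s^-1%g (lshift k i)).
      by rewrite tnth_mktuple mxE permKV col_mxEu mxE.
    have := xyA (s^-1%g (rshift r i)).
    by rewrite tnth_mktuple mxE permKV col_mxEd mxE.
  move=> [xA yA] i; rewrite tnth_mktuple mxE -{1}(permK s i).
  move: (s i) => j; rewrite -(fintype.splitK j).
  case: (fintype.split j) => a /=; first by rewrite col_mxEu mxE; exact: xA.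
  by rewrite col_mxEd mxE; exact: yA.
have mA1 i : measurable (A1 i) by exact: mA.
have mA2 i : measurable (A2 i) by exact: mA.
rewrite product_measure1E; [|exact: measurable_box..].
transitivity ((\prod_(i < r) lebesgue_measure (A1 i)) *
              (\prod_(i < k) lebesgue_measure (A2 i)))%E.
  by congr (_ * _)%E; exact: lebesgue_tuple_box.
by rewrite [RHS](reindex_perm s^-1%g)/= big_split_ord.
Qed.

Lemma integral_tuple_glue r k (s : 'S_(r + k)) (f : (r + k).-tuple R -> \bar R) :
  measurable_fun setT f -> (forall t, 0 <= f t)%E ->
  (\int[lebesgue_tuple (r + k)]_t f t =
   \int[lebesgue_tuple r \x lebesgue_tuple k]_q f (tuple_glue s q))%E.
Proof.
move=> mf f0.
rewrite -[RHS](ge0_integral_pushforward (measurable_tuple_glue s)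
  (lebesgue_tuple r \x lebesgue_tuple k)%E measurableT mf)//.
apply: eq_measure_integral; first exact: measurable_tuple_glue.
by move=> mg A mA _; exact: lebesgue_tuple_glue.
Qed.

(** * Measures with a density *)

(** Densities are stated through nonnegative test functions, the form in which
    they combine with Tonelli's theorem. *)
Definition has_density d (T : measurableType d) (nu mu : {measure set T -> \bar R})
    (p : T -> R) :=
  forall f, measurable_fun setT f -> (forall x, 0 <= f x)%E ->
  (\int[nu]_x f x = \int[mu]_x (f x * (p x)%:E))%E.

(** The Radon-Nikodym derivative is almost everywhere [p], so the change of
    variables formula for the derivative extends the density from sets to test
    functions. *)
Lemma has_densityP d (T : measurableType d) (nu : {finite_measure set T -> \bar R})
    (mu : {sigma_finite_measure set T -> \bar R}) (p : T -> R) :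
  measurable_fun setT p -> (forall x, 0 <= p x) ->
  (forall A, measurable A -> nu A = \int[mu]_(x in A) (p x)%:E)%E ->
  has_density nu mu p.
Proof.
move=> mp p0 nuE f mf f0.
have mep : measurable_fun setT (EFin \o p) by exact/measurable_EFinP.
have numu : nu `<< mu.
  apply/null_content_dominatesP => A mA muA0; rewrite nuE//.
  apply: null_set_integral => //; exact: measurable_funTS.
rewrite -(Radon_Nikodym_SigmaFinite.change_of_variables numu f0 measurableT mf).
apply: ge0_ae_eq_integral => //.
- apply: emeasurable_funM => //.
  exact: (measurable_int mu (Radon_Nikodym_SigmaFinite.f_integrable numu)).
- exact: emeasurable_funM.
- by move=> x _; rewrite mule_ge0// Radon_Nikodym_SigmaFinite.f_ge0.
- by move=> x _; rewrite mule_ge0// lee_fin.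
apply: ae_eqe_mul2l.
apply: integral_ae_eq => //.
- exact: Radon_Nikodym_SigmaFinite.f_integrable.
- move=> A _ mA; rewrite -nuE//.
  by rewrite -Radon_Nikodym_SigmaFinite.f_integral.
Qed.

Lemma has_density_measure d (T : measurableType d)
    (nu mu : {measure set T -> \bar R}) (p : T -> R) A :
  measurable A -> has_density nu mu p ->
  (nu A = \int[mu]_(x in A) (p x)%:E)%E.
Proof.
move=> mA nuE; rewrite -[A in LHS]setIT -(integral_indic nu)//.
rewrite nuE//; last exact/measurable_EFinP/measurable_indic.
rewrite [RHS]integral_mkcond; apply: eq_integral => x _.
by rewrite epatch_indic/= muleC.
Qed.

End coordinates.

(** * Centred Gaussian densities *)

Section gaussian.
Context {R : realType}.

Definition gauss_pdf n (Gamma : 'M[R]_n) (v : 'cV[R]_n) := normal_vec_pdf 0 Gamma v.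

Lemma gauss_pdfE n (Gamma : 'M[R]_n) v : gauss_pdf Gamma v =
  (Num.sqrt ((2 * pi) ^+ n * \det Gamma))^-1 * expR (- quad (invmx Gamma) v / 2).
Proof. by rewrite /gauss_pdf /normal_vec_pdf subr0. Qed.

Lemma gauss_pdf_ge0 n (Gamma : 'M[R]_n) v : 0 <= gauss_pdf Gamma v.
Proof. by rewrite gauss_pdfE mulr_ge0 ?expR_ge0// invr_ge0 sqrtr_ge0. Qed.

Lemma gauss_pdf_gt0 n (Gamma : 'M[R]_n) v : posdefmx Gamma -> 0 < gauss_pdf Gamma v.
Proof.
move=> G0; rewrite gauss_pdfE mulr_gt0 ?expR_gt0// invr_gt0 sqrtr_gt0 mulr_gt0//.
  by rewrite exprn_gt0// mulr_gt0// pi_gt0.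
exact: posdefmx_det_gt0.
Qed.

Lemma ln_sqrt (a : R) : 0 < a -> ln (Num.sqrt a) = 2^-1 * ln a.
Proof.
move=> a0; rewrite -{2}(sqr_sqrtr (ltW a0)) lnXn ?sqrtr_gt0//.
by rewrite -(mulr_natl (ln _)) mulKf// pnatr_eq0.
Qed.

Lemma ln_gauss_pdf l (Gamma : 'M[R]_l) v : posdefmx Gamma ->
  ln (gauss_pdf Gamma v) =
  - (2^-1 * (ln ((2 * pi) ^+ l) + ln (\det Gamma))) - quad (invmx Gamma) v / 2.
Proof.
move=> Gpos; have G0 := posdefmx_det_gt0 Gpos.
have c0 : 0 < (2 * pi : R) ^+ l by rewrite exprn_gt0// mulr_gt0// pi_gt0.
rewrite gauss_pdfE lnM ?posrE ?expR_gt0 ?invr_gt0 ?sqrtr_gt0 ?mulr_gt0// expRK.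
by rewrite lnV ?posrE ?sqrtr_gt0 ?mulr_gt0// ln_sqrt ?mulr_gt0// lnM// mulNr.
Qed.

Lemma measurable_gauss_pdf d (T : measurableType d) n (Gamma : 'M[R]_n) (g : T -> 'cV[R]_n) :
  measurable_cv g -> measurable_fun setT (fun t => gauss_pdf Gamma (g t)).
Proof. exact: measurable_normal_vec_pdf. Qed.

Lemma gauss_pdf_linear n (K D : 'M[R]_n) v : posdefmx D -> (\det K) ^+ 2 = 1 ->
  gauss_pdf (K *m D *m K^T) (K *m v) = gauss_pdf D v.
Proof.
move=> Dpos K1; have Du := posdefmx_unit Dpos.
have Ku : K \in unitmx.
  rewrite unitmxE unitfE; apply: contra_eq_neq K1 => ->.
  by rewrite expr0n eq_sym oner_eq0.
have KDKu : K *m D *m K^T \in unitmx by rewrite !unitmx_mul Ku Du unitmx_tr.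
rewrite !gauss_pdfE !det_mulmx det_tr mulrAC -expr2 K1 mul1r quad_mulmx.
suff -> : K^T *m invmx (K *m D *m K^T) *m K = invmx D by [].
apply: (can_inj (mulKmx Du)); rewrite mulmxV//.
apply: (can_inj (mulKmx Ku)); rewrite mulmx1 !mulmxA mulmxV//.
by rewrite mul1mx.
Qed.

Lemma gauss_pdf_block_diag n k (A : 'M[R]_n) (B : 'M[R]_k) x y :
  posdefmx A -> posdefmx B ->
  gauss_pdf (block_mx A 0 0 B) (col_mx x y) = gauss_pdf A x * gauss_pdf B y.
Proof.
move=> Apos Bpos.
have Au := posdefmx_unit Apos; have Bu := posdefmx_unit Bpos.
have Du : block_mx A 0 0 B \in unitmx.
  by rewrite unitmxE det_ublock unitrM -!unitmxE Au.
have invD : invmx (block_mx A 0 0 B) = block_mx (invmx A) 0 0 (invmx B).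
  apply: (can_inj (mulKmx Du)); rewrite mulmxV// mulmx_block.
  by rewrite !mulmx0 !mul0mx !addr0 !add0r !mulmxV// -scalar_mx_block.
rewrite !gauss_pdfE invD det_ublock.
have -> : quad (block_mx (invmx A) 0 0 (invmx B)) (col_mx x y) =
   quad (invmx A) x + quad (invmx B) y.
  rewrite /quad tr_col_mx mul_row_block !mulmx0 addr0 add0r mul_row_col.
  by rewrite mxE.
have pi2 : 0 <= 2 * pi :> R by rewrite mulr_ge0// pi_ge0.
rewrite exprD mulrACA sqrtrM; last first.
  by rewrite mulr_ge0 ?exprn_ge0// ltW// posdefmx_det_gt0.
have -> a b : - (a + b) / 2 = - a / 2 + - b / 2 :> R by lra.
by rewrite expRD invfM mulrACA.
Qed.

Lemma posdefmx_ulsub n k (A : 'M[R]_(n + k)) : posdefmx A -> posdefmx (ulsubmx A).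
Proof.
move=> Apos.
have -> : ulsubmx A = (col_mx 1%:M 0)^T *m A *m col_mx 1%:M (0 : 'M[R]_(k, n)).
  rewrite -{2}[A]submxK tr_col_mx mul_row_block trmx1 trmx0 !mul1mx !mul0mx !addr0.
  by rewrite mul_row_col mulmx1 mulmx0 addr0.
apply: posdefmx_congr => // v; rewrite mul_col_mx mul1mx => /(congr1 usubmx).
by rewrite col_mxKu linear0.
Qed.

Lemma posdefmx_drsub n k (A : 'M[R]_(n + k)) : posdefmx A -> posdefmx (drsubmx A).
Proof.
move=> Apos.
have -> : drsubmx A = (col_mx 0 1%:M)^T *m A *m col_mx (0 : 'M[R]_(n, k)) 1%:M.
  rewrite -{2}[A]submxK tr_col_mx mul_row_block trmx1 trmx0 !mul1mx !mul0mx !add0r.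
  by rewrite mul_row_col mulmx1 mulmx0 add0r.
apply: posdefmx_congr => // v; rewrite mul_col_mx mul1mx => /(congr1 dsubmx).
by rewrite col_mxKd linear0.
Qed.

Lemma posdefmx_block_diag n k (A : 'M[R]_n) (B : 'M[R]_k) :
  posdefmx A -> posdefmx B -> posdefmx (block_mx A 0 0 B).
Proof.
move=> [Asym Apos] [Bsym Bpos]; split.
  by rewrite tr_block_mx !trmx0 Asym Bsym.
move=> v; rewrite -[v]vsubmxK tr_col_mx mul_row_block !mulmx0 addr0 add0r.
rewrite mul_row_col mxE.
have qA := Apos (usubmx v); have qB := Bpos (dsubmx v).
have [u0|u0] := eqVneq (usubmx v) 0; have [d0|d0] := eqVneq (dsubmx v) 0.
- by rewrite u0 d0 col_mx0 eqxx.
- by move=> _; rewrite u0 mulmx0 [X in X + _]mxE add0r qB.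
- by move=> _; rewrite d0 mulmx0 [X in _ + X]mxE addr0 qA.
- by move=> _; rewrite addr_gt0 ?qA ?qB.
Qed.

(** Conditioning on the last coordinates: [S] is the Schur complement of the
    lower right block, which block elimination isolates by a unitriangular
    change of variables, and [C *m y] is the conditional mean. *)
Lemma gauss_pdf_schur n k (Gamma : 'M[R]_(n + k)) : posdefmx Gamma ->
  exists (S : 'M[R]_n) (C : 'M[R]_(n, k)), posdefmx S /\ forall x y,
    gauss_pdf Gamma (col_mx x y) = gauss_pdf S (x - C *m y) * gauss_pdf (drsubmx Gamma) y.
Proof.
move=> Gpos; have Dpos := posdefmx_drsub Gpos; have Du := posdefmx_unit Dpos.
have [Gsym _] := Gpos; have [Dsym _] := Dpos.
pose C := ursubmx Gamma *m invmx (drsubmx Gamma).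
pose L : 'M[R]_(n + k) := block_mx 1%:M (- C) 0 1%:M.
pose K : 'M[R]_(n + k) := block_mx 1%:M C 0 1%:M.
have KL : K *m L = 1%:M.
  rewrite mulmx_block !(mul1mx, mulmx1, mul0mx, mulmx0, addr0, add0r).
  by rewrite addNr -scalar_mx_block.
have LK := mulmx1C KL.
have detK : (\det K) ^+ 2 = 1 by rewrite det_ublock !det1 mulr1 expr1n.
pose E := L *m Gamma *m L^T.
have Epos : posdefmx E.
  rewrite /E -{1}[L]trmxK; apply: posdefmx_congr => // v /(congr1 (mulmx K^T)).
  by rewrite mulmx0 mulmxA -trmx_mul LK trmx1 mul1mx.
have EE : E = block_mx (ulsubmx E) 0 0 (drsubmx Gamma).
  have [Esym _] := Epos.
  have urE : ursubmx E = 0.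
    rewrite /E -{1}[Gamma]submxK mulmx_block tr_block_mx mulmx_block block_mxKur.
    rewrite !(mul1mx, mulmx1, mul0mx, mulmx0, addr0, add0r, trmx1, trmx0).
    by rewrite mulNmx -mulmxA mulVmx// mulmx1 subrr.
  rewrite -[LHS]submxK urE; congr block_mx.
    by rewrite -[LHS]trmxK trmx_dlsub Esym urE trmx0.
  rewrite /E -{1}[Gamma]submxK mulmx_block tr_block_mx mulmx_block block_mxKdr.
  by rewrite !(mul1mx, mulmx1, mul0mx, mulmx0, addr0, add0r, trmx1, trmx0).
have GE : Gamma = K *m E *m K^T.
  by rewrite /E !mulmxA KL mul1mx -mulmxA -trmx_mul KL trmx1 mulmx1.
exists (ulsubmx E), C; split; first exact: posdefmx_ulsub.
move=> x y; rewrite -gauss_pdf_block_diag//; last exact: posdefmx_ulsub.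
rewrite -EE {1}GE -(gauss_pdf_linear _ Epos detK); congr gauss_pdf.
by rewrite mul_block_col !mul1mx mul0mx add0r subrK.
Qed.

Lemma gauss_pdf_dim1 (S : 'M[R]_1) (m x : R) : posdefmx S ->
  gauss_pdf S (x%:M - m%:M) = normal_pdf m (Num.sqrt (S 0 0)) x.
Proof.
move=> Spos.
have s0 : 0 < S 0 0.
  by have := posdefmx_det_gt0 Spos; rewrite det_mx11.
rewrite normal_pdfE ?gt_eqF ?sqrtr_gt0// /normal_peak /normal_fun.
rewrite gauss_pdfE sqr_sqrtr ?ltW//.
have -> : invmx S = (S 0 0)^-1%:M.
  apply: (can_inj (mulKmx (posdefmx_unit Spos))).
  rewrite mulmxV ?posdefmx_unit// {1}[S]mx11_scalar -scalar_mxM mulfV//.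
  by rewrite gt_eqF.
rewrite -raddfB /quad tr_scalar_mx -!scalar_mxM mxE eqxx mulr1n expr1 det_mx11.
congr (_^-1 * expR _).
  by congr Num.sqrt; rewrite mulrC mulr_natl mulrnAr mulrC -mulr_natl; ring.
by field; rewrite gt_eqF.
Qed.


Lemma integral_tuple_cons n (f : n.+1.-tuple R -> \bar R) :
  measurable_fun setT f -> (forall t, 0 <= f t)%E ->
  (\int[lebesgue_tuple n.+1]_t f t =
   \int[lebesgue_tuple n]_t \int[lebesgue_measure]_x f (tuple_cons (x, t)))%E.
Proof.
move=> mf f0.
have mft : measurable_fun setT (f \o @tuple_cons R n).
  exact: measurableT_comp (@measurable_tuple_cons R n).
rewrite -[RHS](fubini_tonelli2 (f \o @tuple_cons R n) mft); last first.
  by move=> t; exact: f0.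
apply: (ge0_integral_pushforward (@measurable_tuple_cons R n)
  (lebesgue_measure \x lebesgue_tuple n)%E measurableT mf).
by move=> t _; exact: f0.
Qed.

Lemma colv_tuple_cons n (x : R) (t : n.-tuple R) :
  colv (tuple_cons (x, t)) = col_mx x%:M (colv t) :> 'cV_(1 + n).
Proof.
apply/colP => i; rewrite -(fintype.splitK i); case: (fintype.split i) => j /=.
  by rewrite col_mxEu !ord1 !mxE eqxx mulr1n.
rewrite col_mxEd !mxE; have -> : rshift 1 j = lift ord0 j by exact/val_inj.
exact: tnthS.
Qed.

(** By [gauss_pdf_schur] for a first block of size 1, the integral over the
    first coordinate is that of a normal density on the line, which leaves a
    Gaussian density in one dimension less. *)
Lemma integral_gauss_pdf n (Gamma : 'M[R]_n) : posdefmx Gamma ->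
  (\int[lebesgue_tuple n]_t (gauss_pdf Gamma (colv t))%:E = 1)%E.
Proof.
elim: n Gamma => [|n IHn] Gamma Gpos.
  rewrite /= integral_dirac//; last first.
    by apply/measurable_EFinP/measurable_gauss_pdf; exact: measurable_colv.
  rewrite diracE in_setT mul1e gauss_pdfE expr0 det_mx00 mulr1 sqrtr1 invr1 mul1r.
  by rewrite (flatmx0 (colv _)) /quad mulmx0 mxE oppr0 mul0r expR0.
have mG : measurable_fun setT (fun t : n.+1.-tuple R => (gauss_pdf Gamma (colv t))%:E).
  by apply/measurable_EFinP/measurable_gauss_pdf; exact: measurable_colv.
have G0 (t : n.+1.-tuple R) : (0 <= (gauss_pdf Gamma (colv t))%:E)%E.
  by rewrite lee_fin gauss_pdf_ge0.
apply: (eq_trans (integral_tuple_cons mG G0)).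
have [S [C [Spos SE]]] := gauss_pdf_schur (Gpos : posdefmx (Gamma : 'M[R]_(1 + n))).
rewrite -(IHn _ (@posdefmx_drsub 1 n _ Gpos)); apply: eq_integral => t _.
have [m mE] : exists m, m%:M = C *m colv t.
  by exists ((C *m colv t) 0 0); rewrite -mx11_scalar.
under eq_integral => x _ do rewrite colv_tuple_cons SE -mE gauss_pdf_dim1// EFinM.
rewrite ge0_integralZr//.
- by rewrite integral_normal_pdf mul1e.
- apply/measurable_EFinP. exact: measurable_normal_pdf.
- by move=> x _; rewrite lee_fin normal_pdf_ge0.
- by rewrite lee_fin gauss_pdf_ge0.
Qed.

(** The conditional density has total mass 1 and is only translated by the
    conditional mean. *)
Lemma integral_gauss_pdf_marginal n k (Gamma : 'M[R]_(n + k)) y : posdefmx Gamma ->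
  (\int[lebesgue_tuple n]_t (gauss_pdf Gamma (col_mx (colv t) y))%:E =
   (gauss_pdf (drsubmx Gamma) y)%:E)%E.
Proof.
move=> Gpos; have [S [C [Spos SE]]] := gauss_pdf_schur Gpos.
under eq_integral do rewrite SE EFinM.
have mS : measurable_fun setT (fun t : n.-tuple R => (gauss_pdf S (colv t))%:E).
  by apply/measurable_EFinP/measurable_gauss_pdf; exact: measurable_colv.
have mSC : measurable_fun setT (fun t : n.-tuple R => (gauss_pdf S (colv t - C *m y))%:E).
  apply/measurable_EFinP/measurable_gauss_pdf; apply: measurable_cvD.
    exact: measurable_colv.
  by move=> i; exact: measurable_cst.
have IS : (\int[lebesgue_tuple n]_t (gauss_pdf S (colv t - C *m y))%:E = 1)%E.
  rewrite -(integral_gauss_pdf Spos) -(integral_translate (- (C *m y)) mS); last first.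
    by move=> t; rewrite lee_fin gauss_pdf_ge0.
  by apply: eq_integral => t _; rewrite vtupleK.
rewrite ge0_integralZr ?IS ?mul1e//.
- by move=> t _; rewrite lee_fin gauss_pdf_ge0.
- by rewrite lee_fin gauss_pdf_ge0.
Qed.

End gaussian.

(** * Marginals on selected coordinates *)

Lemma perm_extend r k (s : 'I_k -> 'I_(r + k)) : injective s ->
  exists p : {perm 'I_(r + k)}, forall j, p (rshift r j) = s j.
Proof.
move=> sinj; pose A := ~: [set s j | j : 'I_k].
have cA : #|A| = r.
  apply/eqP; rewrite -(eqn_add2l k) -[X in (X + _ == _)%N](card_ord k).
  by rewrite -(card_imset _ sinj) cardsC card_ord addnC.
pose f i := match fintype.split i with
  | inl a => enum_val (cast_ord (esym cA) a) | inr b => s b end.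
have fl a : f (lshift k a) \in A.
  by rewrite /f (unsplitK (inl a)) enum_valP.
have fr b : f (rshift r b) = s b by rewrite /f (unsplitK (inr b)).
have sA b : s b \notin A by rewrite inE negbK imset_f.
have finj : injective f.
  move=> i j; rewrite -(fintype.splitK i) -(fintype.splitK j).
  case: (fintype.split i) => a; case: (fintype.split j) => b /=.
  - by rewrite /f !(unsplitK (inl _)) => /enum_val_inj/cast_ord_inj ->.
  - by move=> fab; have := fl a; rewrite fab fr (negbTE (sA b)).
  - by move=> fab; have := fl b; rewrite -fab fr (negbTE (sA a)).
  - by rewrite !fr => /sinj ->.
by exists (perm finj) => j; rewrite permE fr.
Qed.

Section select.
Context {R : realType}.

(** The image of N(0, Gamma) by [S^T] is N(0, S^T Gamma S). A permutation that
    extends [s] moves the selected coordinates to the end without changing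
    Lebesgue measure; the others are then integrated out. *)
Lemma integral_gauss_pdf_select m k (s : 'I_k -> 'I_m) (Gamma : 'M[R]_m)
    (f : k.-tuple R -> \bar R) (S := selection_mx s : 'M[R]_(m, k)) :
  injective s -> posdefmx Gamma ->
  measurable_fun setT f -> (forall t, 0 <= f t)%E ->
  (\int[lebesgue_tuple m]_t (f (vtuple (S^T *m colv t)) * (gauss_pdf Gamma (colv t))%:E) =
   \int[lebesgue_tuple k]_t (f t * (gauss_pdf (S^T *m Gamma *m S) (colv t))%:E))%E.
Proof.
move=> sinj; have km : (k <= m)%N by have := leq_card s sinj; rewrite !card_ord.
have [r mE] : exists r, m = (r + k)%N by exists (m - k)%N; rewrite subnK.
subst m => Gpos mf f0; have [p pE] := perm_extend sinj.
pose W : 'M[R]_(r + k) := perm_mx p^-1%g.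
have Wt : W *m W^T = 1%:M by rewrite /W tr_perm_mx -perm_mxM mulgV perm_mx1.
have tW := mulmx1C Wt.
have detW : (\det W) ^+ 2 = 1 by rewrite det_perm sqrr_sign.
pose D := W^T *m Gamma *m W.
have Dpos : posdefmx D.
  apply: posdefmx_congr => // v /(congr1 (mulmx W^T)).
  by rewrite mulmxA tW mul1mx mulmx0.
have GE : Gamma = W *m D *m W^T.
  by rewrite /D !mulmxA Wt mul1mx -mulmxA Wt mulmx1.
have SE : S = W *m col_mx 0 1%:M.
  apply/matrixP => i j; rewrite /W -row_permE !mxE -{1}(permKV p i).
  rewrite (can2_eq (permK p) (permKV p)) -pE permK.
  move: (p^-1%g i) => l; rewrite -(fintype.splitK l).
  case: (fintype.split l) => a /=; first by rewrite (unsplitK (inl _)) mxE eq_lrshift.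
  by rewrite (unsplitK (inr _)) mxE eq_rshift.
have DE : S^T *m Gamma *m S = drsubmx D.
  rewrite SE trmx_mul !mulmxA -(mulmxA _ W^T) -(mulmxA _ _ W) -/D -[in LHS](submxK D).
  rewrite tr_col_mx trmx1 trmx0 mul_row_block mul_row_col.
  by rewrite !(mul1mx, mulmx1, mul0mx, mulmx0, addr0, add0r).
rewrite DE.
have mF : measurable_fun setT (fun t : (r + k).-tuple R =>
    f (vtuple (S^T *m colv t)) * (gauss_pdf Gamma (colv t))%:E)%E.
  apply: emeasurable_funM.
    apply: measurableT_comp => //; apply: measurable_vtuple.
    by apply: measurable_cv_mulmx; exact: measurable_colv.
  by apply/measurable_EFinP/measurable_gauss_pdf; exact: measurable_colv.
have F0 (t : (r + k).-tuple R) :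
    (0 <= f (vtuple (S^T *m colv t)) * (gauss_pdf Gamma (colv t))%:E)%E.
  by rewrite mule_ge0// lee_fin gauss_pdf_ge0.
pose H (q : r.-tuple R * k.-tuple R) :=
  (f q.2 * (gauss_pdf D (col_mx (colv q.1) (colv q.2)))%:E)%E.
have H0 q : (0 <= H q)%E by rewrite mule_ge0// lee_fin gauss_pdf_ge0.
have mH : measurable_fun setT H.
  apply: emeasurable_funM; first exact: measurableT_comp.
  apply/measurable_EFinP/measurable_gauss_pdf; apply: measurable_col_mx.
    exact: measurable_colv.
  exact: measurable_colv.
transitivity (\int[lebesgue_tuple r \x lebesgue_tuple k]_q H q)%E.
  rewrite (integral_tuple_glue p^-1%g mF F0).
  apply: eq_integral => -[x y] _; rewrite /H/= /tuple_glue.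
  rewrite vtupleK row_permE -/W {1}GE gauss_pdf_linear//.
  rewrite SE trmx_mul -mulmxA (mulmxA W^T) tW mul1mx tr_col_mx trmx0 trmx1.
  by rewrite mul_row_col mul0mx mul1mx add0r colvK.
rewrite fubini_tonelli2//; apply: eq_integral => y _; rewrite /fubini_G /H/=.
rewrite ge0_integralZl//.
- by rewrite integral_gauss_pdf_marginal.
- apply/measurable_EFinP/measurable_gauss_pdf; apply: measurable_col_mx.
    exact: measurable_colv.
  by move=> i; exact: measurable_cst.
- by move=> x _; rewrite lee_fin gauss_pdf_ge0.
Qed.

End select.

(** * The mean of half the squared Mahalanobis norm *)

Section half_moment.
Context {R : realType}.

(** Multiplying the density by [exp (- (a - 1) Q / 2)], where [Q] is the squared
    Mahalanobis norm, rescales the covariance by [a^-1], up to a constant. *)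
Lemma gauss_pdf_tilt n (Gamma : 'M[R]_n) (a : R) v : posdefmx Gamma -> 0 < a ->
  expR (- ((a - 1) * (quad (invmx Gamma) v / 2))) * gauss_pdf Gamma v =
  (Num.sqrt (a ^+ n))^-1 * gauss_pdf (a^-1 *: Gamma) v.
Proof.
move=> Gpos a0; have Gu := posdefmx_unit Gpos.
have aG : invmx (a^-1 *: Gamma) = a *: invmx Gamma.
  by rewrite invmxZ ?invrK// unitmxZ ?unitfE// gt_eqF ?invr_gt0.
have qE : quad (a *: invmx Gamma) v = a * quad (invmx Gamma) v.
  by rewrite /quad -scalemxAr -scalemxAl mxE.
have an : 0 < a ^+ n by rewrite exprn_gt0.
have NE : Num.sqrt ((2 * pi) ^+ n * \det Gamma) =
    Num.sqrt (a ^+ n) * Num.sqrt ((2 * pi) ^+ n * \det (a^-1 *: Gamma)).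
  by rewrite -sqrtrM ?ltW// detZ exprVn mulrCA mulVKf// gt_eqF.
rewrite !gauss_pdfE aG qE NE invfM mulrCA [RHS]mulrA; congr (_ * _).
by rewrite -expRD; congr expR; field.
Qed.

Lemma posdefmxZ n (Gamma : 'M[R]_n) a : 0 < a -> posdefmx Gamma -> posdefmx (a *: Gamma).
Proof.
move=> a0 [Gsym Gpos]; split; first by rewrite linearZ/= Gsym.
by move=> v v0; rewrite -scalemxAr -scalemxAl mxE mulr_gt0// Gpos.
Qed.

(** The Laplace transform of [Q / 2] depends on the dimension only. *)
Lemma integral_tilt n (Gamma : 'M[R]_n) (a : R) : posdefmx Gamma -> 0 < a ->
  (\int[lebesgue_tuple n]_t
    ((expR (- ((a - 1) * (quad (invmx Gamma) (colv t) / 2))))%:E * (gauss_pdf Gamma (colv t))%:E) =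
   ((Num.sqrt (a ^+ n))^-1)%:E)%E.
Proof.
move=> Gpos a0.
have aGpos : posdefmx (a^-1 *: Gamma) by apply: posdefmxZ; rewrite ?invr_gt0.
under eq_integral do rewrite -EFinM gauss_pdf_tilt// EFinM.
rewrite ge0_integralZl//.
- by rewrite integral_gauss_pdf// mule1.
- by apply/measurable_EFinP/measurable_gauss_pdf; exact: measurable_colv.
- by move=> t _; rewrite lee_fin gauss_pdf_ge0.
Qed.

(* Difference quotients of the exponential: for [x >= 0], [g x n] increases to
   [x]. Halving the step [h n] makes the monotonicity that of [y ^+ 2]
   against [2 * y - 1]. *)
Let h (n : nat) : R := (2^-1) ^+ n.
Let g (x : R) n := (1 - expR (- (h n * x))) / h n.

Let h_gt0 n : 0 < h n. Proof. by rewrite exprn_gt0// invr_gt0. Qed.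

Let g_ge0 x n : 0 <= x -> 0 <= g x n.
Proof.
move=> x0; apply: divr_ge0; last exact/ltW/h_gt0.
by rewrite subr_ge0 -expR0 ler_expR oppr_le0 mulr_ge0// ltW// h_gt0.
Qed.

Let g_nd x : nondecreasing_seq (g x).
Proof.
apply/nondecreasing_seqP => n; rewrite /g; set y := expR (- (h n.+1 * x)).
have hS : h n = 2 * h n.+1 by rewrite /h exprS mulrA divff// mul1r.
have -> : expR (- (h n * x)) = y ^+ 2.
  by rewrite hS /y expr2 -expRD; congr expR; ring.
rewrite hS ler_pdivrMr ?mulr_gt0// mulrCA -mulrA mulVf ?gt_eqF// mulr1.
by have := sqr_ge0 (1 - y); lra.
Qed.

Let g_cvg x : 0 <= x -> g x n @[n --> \oo] --> x.
Proof.
move=> x0.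
have hc : h n @[n --> \oo] --> 0.
  by apply: cvg_expr; rewrite ger0_norm ?invr_ge0// invf_lt1// ltr1n.
apply: (@squeeze_cvgr _ _ _ _ (fun n => x - x ^+ 2 * h n) (fun=> x)).
- apply: nearW => n; apply/andP; split.
    rewrite ler_pdivlMr//.
    have u0 : 0 <= h n * x by rewrite mulr_ge0// ltW.
    (* exp (- u) <= 1 / (1 + u) <= 1 - u + u^2 at u = h n * x *)
    have u1 : expR (- (h n * x)) <= (1 + h n * x)^-1.
      by rewrite expRN lef_pV2 ?posrE ?expR_gt0 ?expR_ge1Dx// ltr_wpDr.
    have u2 : (1 + h n * x)^-1 <= 1 - h n * x + (h n * x) ^+ 2.
      rewrite -[leLHS]mul1r ler_pdivrMr ?ltr_wpDr//.
      have -> : (1 - h n * x + (h n * x) ^+ 2) * (1 + h n * x) = 1 + (h n * x) ^+ 3 by ring.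
      by rewrite lerDl exprn_ge0.
    by have := le_trans u1 u2; lra.
  rewrite ler_pdivrMr//; have := expR_ge1Dx (- (h n * x)); lra.
- rewrite [X in _ --> X](_ : x = x - x ^+ 2 * 0); last by rewrite mulr0 subr0.
  by apply: cvgB; [exact: cvg_cst|apply: cvgM => //; exact: cvg_cst].
- exact: cvg_cst.
Qed.

Lemma quad_inv_ge0 n (Gamma : 'M[R]_n) v : posdefmx Gamma -> 0 <= quad (invmx Gamma) v.
Proof.
move=> Gpos; have [->|v0] := eqVneq v 0; first by rewrite /quad mulmx0 mxE.
by apply: ltW; apply: (posdefmx_inv Gpos).2.
Qed.

Definition half_moment_density n (Gamma : 'M[R]_n) (t : n.-tuple R) : \bar R :=
  ((quad (invmx Gamma) (colv t) / 2)%:E * (gauss_pdf Gamma (colv t))%:E)%E.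

Definition half_moment n (Gamma : 'M[R]_n) :=
  (\int[lebesgue_tuple n]_t half_moment_density Gamma t)%E.

Lemma half_moment_density_ge0 n (Gamma : 'M[R]_n) t : posdefmx Gamma ->
  (0 <= half_moment_density Gamma t)%E.
Proof.
by move=> Gpos; rewrite mule_ge0// lee_fin ?gauss_pdf_ge0// divr_ge0// quad_inv_ge0.
Qed.

Lemma measurable_half_moment_density n (Gamma : 'M[R]_n) :
  measurable_fun setT (half_moment_density Gamma).
Proof.
apply: emeasurable_funM; apply/measurable_EFinP.
  by apply: measurable_funM => //; apply: measurable_quad; exact: measurable_colv.
by apply: measurable_gauss_pdf; exact: measurable_colv.
Qed.

(* The mean of [g (Q / 2) j], given by the Laplace transform. *)
Let L n (j : nat) : R := (1 - (Num.sqrt ((1 + h j) ^+ n))^-1) / h j.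

Lemma integral_g n (Gamma : 'M[R]_n) j : posdefmx Gamma ->
  (\int[lebesgue_tuple n]_t
    ((g (quad (invmx Gamma) (colv t) / 2) j)%:E * (gauss_pdf Gamma (colv t))%:E) =
   (L n j)%:E)%E.
Proof.
move=> Gpos; pose q (t : n.-tuple R) := quad (invmx Gamma) (colv t) / 2.
have mp : measurable_fun setT (fun t : n.-tuple R => (gauss_pdf Gamma (colv t))%:E).
  by apply/measurable_EFinP/measurable_gauss_pdf; exact: measurable_colv.
have mq : measurable_fun setT q.
  by apply: measurable_funM => //; apply: measurable_quad; exact: measurable_colv.
have q0 t : 0 <= q t by rewrite divr_ge0// quad_inv_ge0.
have p0 (t : n.-tuple R) : (0 <= (gauss_pdf Gamma (colv t))%:E)%E.
  by rewrite lee_fin gauss_pdf_ge0.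
have mE : measurable_fun setT (fun t => (expR (- (h j * q t)))%:E).
  apply/measurable_EFinP; apply: measurableT_comp => //.
  by apply: measurableT_comp => //; apply: measurable_funM.
have mg : measurable_fun setT (fun t => (g (q t) j)%:E).
  apply/measurable_EFinP; apply: measurable_funM => //; apply: measurable_funB => //.
  exact/measurable_EFinP.
(* the integrals of [h * g * gauss_pdf] and of the tilted density add up to 1 *)
have h1 : (\int[lebesgue_tuple n]_t ((h j)%:E * ((g (q t) j)%:E * (gauss_pdf Gamma (colv t))%:E))
   + ((Num.sqrt ((1 + h j) ^+ n))^-1)%:E = 1)%E.
  rewrite -(integral_gauss_pdf Gpos).
  have := integral_tilt Gpos (_ : 0 < 1 + h j); rewrite addrAC subrr add0r.
  move=> /(_ (addr_gt0 ltr01 (h_gt0 j))) <-; rewrite -ge0_integralD//.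
  - apply: eq_integral => t _; rewrite muleA -muleDl//.
    rewrite -/(q t) -[RHS]mul1e; congr (_ * _)%E.
    by rewrite -EFinM -EFinD /g mulrC divfK ?gt_eqF// subrK.
  - by move=> t _; rewrite !mule_ge0// lee_fin ?g_ge0// ltW.
  - by apply: emeasurable_funM => //; apply: emeasurable_funM.
  - by move=> t _; rewrite mule_ge0// lee_fin expR_ge0.
  - exact: emeasurable_funM.
move: h1; rewrite ge0_integralZl//; last 3 first.
- exact: emeasurable_funM.
- by move=> t _; rewrite mule_ge0// lee_fin g_ge0.
- by rewrite lee_fin ltW.
rewrite -/(q _).
set I := integral _ _ _; move: I => [I| |]; last 2 first.
- by rewrite gt0_muley ?lte_fin// addye.
- by rewrite gt0_muleNy ?lte_fin// addNye.
rewrite -EFinM -EFinD => -[] hI; congr EFin; rewrite /L.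
by apply/(canRL (mulfK _)); [rewrite gt_eqF|move: hI; set s := _^-1; lra].
Qed.

(** Monotone convergence, for [g (Q / 2) j] increases to [Q / 2]. *)
Lemma half_moment_lim n (Gamma : 'M[R]_n) : posdefmx Gamma ->
  half_moment Gamma = limn (fun j => (L n j)%:E).
Proof.
move=> Gpos; pose q (t : n.-tuple R) := quad (invmx Gamma) (colv t) / 2.
under eq_fun do rewrite -(integral_g _ Gpos).
have mp : measurable_fun setT (fun t : n.-tuple R => (gauss_pdf Gamma (colv t))%:E).
  by apply/measurable_EFinP/measurable_gauss_pdf; exact: measurable_colv.
have mq : measurable_fun setT q.
  by apply: measurable_funM => //; apply: measurable_quad; exact: measurable_colv.
have q0 t : 0 <= q t by rewrite divr_ge0// quad_inv_ge0.
have p0 (t : n.-tuple R) : (0 <= (gauss_pdf Gamma (colv t))%:E)%E.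
  by rewrite lee_fin gauss_pdf_ge0.
rewrite -monotone_convergence//.
- apply: eq_integral => t _; apply/esym/cvg_lim => //.
  rewrite /half_moment_density -EFinM; under eq_fun do rewrite -EFinM.
  by apply: cvg_EFin; [exact: nearW|apply: cvgM; [apply: g_cvg; exact: q0|exact: cvg_cst]].
- move=> j; apply: emeasurable_funM => //.
  apply/measurable_EFinP; apply: measurable_funM => //; apply: measurable_funB => //.
  by apply: measurableT_comp => //; apply: measurableT_comp => //; apply: measurable_funM.
- by move=> j t _; rewrite mule_ge0// lee_fin; apply: g_ge0; exact: q0.
- by move=> t _ i j ij; rewrite lee_wpmul2r// lee_fin; apply: g_nd.
Qed.

(** The limit in [half_moment_lim] does not involve the covariance. *)
Lemma half_moment_eq n (Gamma Gamma' : 'M[R]_n) :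
  posdefmx Gamma -> posdefmx Gamma' -> half_moment Gamma = half_moment Gamma'.
Proof. by move=> Gpos Gpos'; rewrite !half_moment_lim. Qed.

(** [Q / 2] is at most [2 * exp (Q / 4)], whose mean is the Laplace transform at
    [-1/2]. *)
Lemma half_moment_ltoo n (Gamma : 'M[R]_n) : posdefmx Gamma -> (half_moment Gamma < +oo)%E.
Proof.
move=> Gpos; have a0 : (0 : R) < 2^-1 by rewrite invr_gt0.
pose E (t : n.-tuple R) :=
  (expR (- ((2^-1 - 1) * (quad (invmx Gamma) (colv t) / 2))))%:E.
have mE : measurable_fun setT E.
  apply/measurable_EFinP; apply: measurableT_comp => //.
  apply: measurableT_comp => //; apply: measurable_funM => //.
  by apply: measurable_funM => //; apply: measurable_quad; exact: measurable_colv.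
have mp : measurable_fun setT (fun t : n.-tuple R => (gauss_pdf Gamma (colv t))%:E).
  by apply/measurable_EFinP/measurable_gauss_pdf; exact: measurable_colv.
have p0 (t : n.-tuple R) : (0 <= (gauss_pdf Gamma (colv t))%:E)%E.
  by rewrite lee_fin gauss_pdf_ge0.
have mEp := emeasurable_funM mE mp.
have Ep0 t : (0 <= E t * (gauss_pdf Gamma (colv t))%:E)%E.
  by rewrite mule_ge0// lee_fin expR_ge0.
have JE := integral_tilt Gpos a0.
apply: (@le_lt_trans _ _ (\int[lebesgue_tuple n]_t
    (2%:E * (E t * (gauss_pdf Gamma (colv t))%:E)))%E); last first.
  by rewrite ge0_integralZl// JE -EFinM ltry.
apply: ge0_le_integral => //.
- by move=> t _; exact: half_moment_density_ge0.
- exact: measurable_half_moment_density.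
- exact: emeasurable_funM.
move=> t _; rewrite muleA lee_wpmul2r// -EFinM lee_fin.
by set x := quad _ _ / 2; have := expR_ge1Dx (- ((2^-1 - 1) * x)); lra.
Qed.

End half_moment.

(** * Divergence from a density *)

Section kl.
Context d (T : measurableType d) (R : realType).
Variables (nu mu : probability T R) (r : T -> R).

(** The Radon-Nikodym derivative in the divergence is defined up to a
    [mu]-negligible set, which is [nu]-negligible as well. *)
Lemma KL_density : measurable_fun setT r -> (forall x, 0 < r x) ->
  has_density nu mu r -> KL_divergence nu mu = (\int[nu]_x (ln (r x))%:E)%E.
Proof.
move=> mr r0 nuE.
have mer : measurable_fun setT (EFin \o r) by exact/measurable_EFinP.
have numu : nu `<< mu.
  apply/null_content_dominatesP => A mA muA0.
  rewrite (has_density_measure mA nuE); apply: null_set_integral => //.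
  exact: measurable_funTS.
rewrite /KL_divergence; case: asboolP => // _.
set D := Radon_Nikodym _ _.
have Dfin x : D x \is a fin_num by exact: Radon_Nikodym_fin_num.
have mD : measurable_fun setT D.
  apply: (measurable_int mu); exact: Radon_Nikodym_integrable.
have DE : ae_eq mu setT D (EFin \o r).
  apply: integral_ae_eq => //; first exact: Radon_Nikodym_integrable.
  move=> E _ mE; rewrite -(has_density_measure mE nuE).
  by rewrite -Radon_Nikodym_integral.
apply: ae_eq_integral => //.
- rewrite (_ : (fun _ => _) = fun x =>
      if fine (D x) <= 0 then -oo%E else (ln (fine (D x)))%:E).
    apply: measurable_fun_ifT => //.
    + apply: measurable_fun_ler => //; exact: measurableT_comp.
    + apply/measurable_EFinP; apply: measurableT_comp => //; exact: measurableT_comp.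
  by apply/funext => x; rewrite -[in LHS](fineK (Dfin x)).
- by apply/measurable_EFinP; exact: measurableT_comp.
- apply: (null_dominates_ae_eq measurableT numu).
  by apply: filterS DE => x /= DEx /DEx ->; exact: lne_EFin.
Qed.

End kl.

(** * Laws of independent and Gaussian vectors *)

Section laws.
Context {R : realType} d (T : measurableType d) (P : probability T R).

Lemma normal_vec_density n (X : {RV P >-> n.-tuple R}) (Gamma : 'M[R]_n) :
  normal_vec X 0 Gamma ->
  has_density (distribution P X) (lebesgue_tuple n) (fun t => gauss_pdf Gamma (colv t)).
Proof.
move=> XN; apply: has_densityP => //.
- by apply: measurable_gauss_pdf; exact: measurable_colv.
- by move=> t; exact: gauss_pdf_ge0.
Qed.

Lemma distribution_pair_independent d1 d2 (T1 : measurableType d1)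
    (T2 : measurableType d2) (X : {RV P >-> T1}) (Y : {RV P >-> T2}) A :
  independent_RV X Y -> measurable A ->
  (distribution P X \x distribution P Y)%E A = distribution P (pair_RV X Y) A.
Proof.
by move=> XY mA; apply: product_measure_unique => // B C mB mC; exact: XY.
Qed.

Lemma has_density_prod d1 d2 (T1 : measurableType d1) (T2 : measurableType d2)
    (nu1 lam1 : {sigma_finite_measure set T1 -> \bar R})
    (nu2 lam2 : {sigma_finite_measure set T2 -> \bar R}) (p1 : T1 -> R) (p2 : T2 -> R) :
  measurable_fun setT p1 -> (forall x, 0 <= p1 x) ->
  measurable_fun setT p2 -> (forall x, 0 <= p2 x) ->
  has_density nu1 lam1 p1 -> has_density nu2 lam2 p2 ->
  has_density (nu1 \x nu2)%E (lam1 \x lam2)%E (fun q => p1 q.1 * p2 q.2).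
Proof.
move=> mp1 p10 mp2 p20 nu1E nu2E f mf f0.
have mF : measurable_fun setT (fun q => f q * (p2 q.2)%:E)%E.
  apply: emeasurable_funM => //; apply/measurable_EFinP.
  exact: measurableT_comp.
have F0 q : (0 <= f q * (p2 q.2)%:E)%E by rewrite mule_ge0// lee_fin.
have mG : measurable_fun setT (fun q => f q * (p1 q.1 * p2 q.2)%:E)%E.
  apply: emeasurable_funM => //; apply/measurable_EFinP; apply: measurable_funM.
    exact: measurableT_comp.
  exact: measurableT_comp.
rewrite [LHS]fubini_tonelli1// [RHS]fubini_tonelli1; last 2 first.
- exact: mG.
- by move=> q; rewrite mule_ge0// lee_fin mulr_ge0.
transitivity (\int[nu1]_x fubini_F lam2 (fun q => f q * (p2 q.2)%:E)%E x)%E.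
  apply: eq_integral => x _; rewrite /fubini_F nu2E//.
  exact: measurableT_comp.
rewrite nu1E; last 2 first.
- exact: measurable_fun_fubini_tonelli_F.
- by move=> x; apply: integral_ge0 => y _.
apply: eq_integral => x _; rewrite /fubini_F -ge0_integralZr//.
- by apply: eq_integral => y _ /=; rewrite -muleA -EFinM mulrC.
- exact: (measurableT_comp mF (pair1_measurable x)).
- by rewrite lee_fin.
Qed.

End laws.

(** * Mutual information with the selected observations *)

Section observation.
Context {R : realType} d (T : measurableType d) (P : probability T R).
Variables (n m k : nat) (G : 'M[R]_(m, n)) (GammaX : 'M[R]_n) (GammaYX : 'M[R]_m).
Variables (X : {RV P >-> n.-tuple R}) (eps : {RV P >-> m.-tuple R})
  (Z : {RV P >-> k.-tuple R}) (s : 'I_k -> 'I_m).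
Hypotheses (GX : posdefmx GammaX) (GYX : posdefmx GammaYX).
Hypotheses (XN : normal_vec X 0 GammaX) (eN : normal_vec eps 0 GammaYX).
Hypotheses (Xe : independent_RV X eps) (sinj : injective s).
Let S : 'M[R]_(m, k) := selection_mx s.
Hypothesis ZE : forall w, colv (Z w) = S^T *m (G *m colv (X w) + colv (eps w)).

Let H := S^T *m G.
Let B := S^T *m GammaYX *m S.
Let C := S^T *m (G *m GammaX *m G^T + GammaYX) *m S.

Let S_inj (v : 'cV[R]_k) : S *m v = 0 -> v = 0.
Proof.
move=> Sv; apply/colP => j; rewrite [RHS]mxE.
have /colP/(_ (s j)) := Sv; rewrite !mxE (bigD1 j)//= mxE eqxx mul1r.
rewrite big1 ?addr0// => l lj; rewrite mxE (inj_eq sinj) eq_sym (negbTE lj).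
by rewrite mul0r.
Qed.

Let Bpos : posdefmx B. Proof. exact: posdefmx_congr. Qed.

(* (X, YS) is the image of the pair (X, S^T eps), which has block diagonal
   covariance, by the shear (x, e) |-> (x, H x + e). *)
Let shear : 'M[R]_(n + k) := block_mx 1%:M 0 H 1%:M.
Let joint_cov := shear *m block_mx GammaX 0 0 B *m shear^T.

Let det_shear : (\det shear) ^+ 2 = 1.
Proof. by rewrite det_lblock !det1 mulr1 expr1n. Qed.

Let joint_pos : posdefmx joint_cov.
Proof.
rewrite /joint_cov -{1}[shear]trmxK; apply: posdefmx_congr => [|v].
  exact: posdefmx_block_diag.
move=> /eqP; rewrite -{1}[v]vsubmxK /shear tr_block_mx mul_block_col !trmx1 trmx0.
rewrite !mul1mx mul0mx add0r col_mx_eq0 => /andP[/eqP + /eqP dv].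
by rewrite dv mulmx0 addr0 => uv; rewrite -[v]vsubmxK uv dv col_mx0.
Qed.

Let joint_drsub : drsubmx joint_cov = C.
Proof.
rewrite /joint_cov /shear tr_block_mx !mulmx_block block_mxKdr.
rewrite !(mul1mx, mulmx1, mul0mx, mulmx0, addr0, add0r, trmx1, trmx0).
by rewrite /C /B /H mulmxDr mulmxDl trmx_mul trmxK !mulmxA.
Qed.

Let Cpos : posdefmx C.
Proof. by rewrite -joint_drsub; exact: posdefmx_drsub. Qed.

Let gauss_pdf_joint x y :
  gauss_pdf joint_cov (col_mx x y) = gauss_pdf GammaX x * gauss_pdf B (y - H *m x).
Proof.
rewrite -gauss_pdf_block_diag// -(gauss_pdf_linear _ (posdefmx_block_diag GX Bpos) det_shear); congr gauss_pdf.
by rewrite mul_block_col !mul1mx mul0mx addr0 addrC subrK.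
Qed.

Let p (q : n.-tuple R * k.-tuple R) :=
  gauss_pdf GammaX (colv q.1) * gauss_pdf B (colv q.2 - H *m colv q.1).

Let measurable_cv1 : measurable_cv (fun q : n.-tuple R * k.-tuple R => colv q.1).
Proof. exact: measurable_colv. Qed.

Let measurable_cv2 : measurable_cv (fun q : n.-tuple R * k.-tuple R => colv q.2).
Proof. exact: measurable_colv. Qed.

Let measurable_res : measurable_cv
  (fun q : n.-tuple R * k.-tuple R => colv q.2 - H *m colv q.1).
Proof.
apply: measurable_cvD; first exact: measurable_cv2.
by apply: measurable_cvN; apply: measurable_cv_mulmx; exact: measurable_cv1.
Qed.

Let measurable_res1 x : measurable_cv (fun y : k.-tuple R => colv y - H *m colv x).
Proof.
apply: measurable_cvD; first exact: measurable_colv.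
by move=> i; exact: measurable_cst.
Qed.

Let measurable_p : measurable_fun setT p.
Proof.
apply: measurable_funM; first by apply: measurable_gauss_pdf; exact: measurable_cv1.
by apply: measurable_gauss_pdf; exact: measurable_res.
Qed.

(** For fixed [x], the density in [y] is that of [S^T eps] translated by
    [H *m x]; independence allows integrating over [eps] first. *)
Lemma joint_density :
  has_density (distribution P (pair_RV X Z)) (lebesgue_tuple n \x lebesgue_tuple k)%E p.
Proof.
move=> f mf f0.
rewrite ge0_integral_distribution//.
pose g (q : n.-tuple R * m.-tuple R) := (q.1, vtuple (H *m colv q.1 + S^T *m colv q.2)).
have mg : measurable_fun setT g.
  apply: measurable_fun_pair => //; apply: measurable_vtuple.
  by apply: measurable_cvD; apply: measurable_cv_mulmx; exact: measurable_colv.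
have gE w : g (X w, eps w) = (X w, Z w).
  by rewrite /g/= -[Z w]colvK ZE mulmxDr mulmxA.
transitivity (\int[P]_w (f \o g \o pair_RV X eps) w)%E.
  by apply: eq_integral => w _ /=; rewrite /pair_RV gE.
have mfg : measurable_fun setT (f \o g) by exact: measurableT_comp.
rewrite -ge0_integral_distribution//; last by move=> q; exact: f0.
transitivity (\int[distribution P X \x distribution P eps]_q (f \o g) q)%E.
  by apply: eq_measure_integral => A mA _; rewrite [RHS]distribution_pair_independent.
have mfp : measurable_fun setT (fun q : n.-tuple R * k.-tuple R =>
    f q * (gauss_pdf B (colv q.2 - H *m colv q.1))%:E)%E.
  apply: emeasurable_funM => //; apply/measurable_EFinP/measurable_gauss_pdf.
  exact: measurable_res.
have fp0 q : (0 <= f q * (gauss_pdf B (colv q.2 - H *m colv q.1))%:E)%E.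
  by rewrite mule_ge0// lee_fin gauss_pdf_ge0.
rewrite fubini_tonelli1//; last by move=> q; exact: f0.
transitivity (\int[distribution P X]_x
    fubini_F (lebesgue_tuple k)
      (fun q => f q * (gauss_pdf B (colv q.2 - H *m colv q.1))%:E)%E x)%E.
  apply: eq_integral => x _; rewrite /fubini_F.
  rewrite (normal_vec_density eN); last 2 first.
  - exact: measurableT_comp.
  - by move=> y; exact: f0.
  have mh : measurable_fun setT (fun z : k.-tuple R => f (x, vtuple (H *m colv x + colv z))).
    apply: measurableT_comp => //; apply: measurable_fun_pair => //.
    apply: measurable_vtuple; apply: measurable_cvD; last exact: measurable_colv.
    by move=> i; exact: measurable_cst.
  have := integral_gauss_pdf_select sinj GYX mh (fun z => f0 _); rewrite -/S -/B => hE.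
  transitivity (\int[lebesgue_tuple m]_t
     (f (x, vtuple (H *m colv x + colv (vtuple (S^T *m colv t)))) *
      (gauss_pdf GammaYX (colv t))%:E))%E.
    by apply: eq_integral => t _; rewrite vtupleK.
  rewrite hE.
  have mfpx := measurableT_comp mfp (pair1_measurable x).
  apply: (eq_trans _ (integral_translate (H *m colv x) mfpx (fun y => fp0 _))).
  by apply: eq_integral => y _ /=; rewrite vtupleK addrK addrC.
rewrite (normal_vec_density XN); last 2 first.
- exact: measurable_fun_fubini_tonelli_F.
- by move=> x; apply: integral_ge0 => y _.
rewrite [RHS]fubini_tonelli1; last 2 first.
- by apply: emeasurable_funM => //; exact/measurable_EFinP.
- by move=> q; rewrite mule_ge0// lee_fin mulr_ge0// gauss_pdf_ge0.
apply: eq_integral => x _; rewrite /fubini_F -ge0_integralZr//.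
- by apply: eq_integral => y _ /=; rewrite -muleA -EFinM mulrC.
- exact: (measurableT_comp mfp (pair1_measurable x)).
- by rewrite lee_fin gauss_pdf_ge0.
Qed.

Lemma integral_snd_pair (f : k.-tuple R -> \bar R) : measurable_fun setT f ->
  (forall t, 0 <= f t)%E ->
  (\int[distribution P (pair_RV X Z)]_q f q.2 = \int[distribution P Z]_t f t)%E.
Proof.
move=> mf f0; rewrite ge0_integral_distribution//; last exact: measurableT_comp.
by rewrite ge0_integral_distribution.
Qed.

(** The joint density is the Gaussian density of covariance [joint_cov], whose
    lower right block is [C]. *)
Lemma observation_density :
  has_density (distribution P Z) (lebesgue_tuple k) (fun t => gauss_pdf C (colv t)).
Proof.
move=> f mf f0; rewrite -integral_snd_pair//.
have mfp : measurable_fun setT (fun q : n.-tuple R * k.-tuple R => f q.2 * (p q)%:E)%E.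
  by apply: emeasurable_funM; [exact: measurableT_comp|exact/measurable_EFinP].
rewrite joint_density//; last exact: measurableT_comp.
rewrite fubini_tonelli2//; last first.
  by move=> q; rewrite mule_ge0// lee_fin mulr_ge0// gauss_pdf_ge0.
apply: eq_integral => y _; rewrite /fubini_G/= ge0_integralZl//.
- rewrite -joint_drsub -integral_gauss_pdf_marginal//; congr (_ * _)%E.
  by apply: eq_integral => x _; rewrite gauss_pdf_joint.
- have mp : measurable_fun setT (EFin \o p) by exact/measurable_EFinP.
  exact: (measurableT_comp mp (pair2_measurable y)).
- by move=> x _; rewrite lee_fin mulr_ge0// gauss_pdf_ge0.
Qed.

Let r (q : n.-tuple R * k.-tuple R) :=
  gauss_pdf B (colv q.2 - H *m colv q.1) / gauss_pdf C (colv q.2).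

Let r_gt0 q : 0 < r q.
Proof. by rewrite divr_gt0// gauss_pdf_gt0. Qed.

Let measurable_gauss_pdfC :
  measurable_fun setT (fun q : n.-tuple R * k.-tuple R => gauss_pdf C (colv q.2)).
Proof. by apply: measurable_gauss_pdf; exact: measurable_cv2. Qed.

Let measurable_r : measurable_fun setT r.
Proof.
apply: measurable_funM; first by apply: measurable_gauss_pdf; exact: measurable_res.
rewrite (_ : (fun _ => _) = fun q : n.-tuple R * k.-tuple R =>
    expR (- ln (gauss_pdf C (colv q.2)))).
  apply: measurableT_comp => //; apply: measurableT_comp => //.
  exact: measurableT_comp.
by apply/funext => q; rewrite expRN lnK// posrE gauss_pdf_gt0.
Qed.

(** The factor f_X is common to the densities of the joint law and of the
    product of the marginals. *)
Lemma joint_density_ratio :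
  has_density (distribution P (pair_RV X Z))
    (distribution P X \x distribution P Z)%E r.
Proof.
move=> f mf f0; rewrite joint_density//.
rewrite (has_density_prod _ _ _ _ (normal_vec_density XN) observation_density).
- apply: eq_integral => q _; rewrite -muleA -EFinM; congr (_ * _%:E)%E.
  by rewrite /p /r/=; field; rewrite gt_eqF// gauss_pdf_gt0.
- by apply: measurable_gauss_pdf; exact: measurable_colv.
- by move=> x; exact: gauss_pdf_ge0.
- by apply: measurable_gauss_pdf; exact: measurable_colv.
- by move=> x; exact: gauss_pdf_ge0.
- by apply: emeasurable_funM => //; exact/measurable_EFinP.
- by move=> q; rewrite mule_ge0// lee_fin ltW.
Qed.

(* Half the squared Mahalanobis norms of [y] for [C] and of the residual
   [y - H x] for [B]; under the joint law both have mean [half_moment]. *)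
Let u (q : n.-tuple R * k.-tuple R) := quad (invmx C) (colv q.2) / 2.
Let v (q : n.-tuple R * k.-tuple R) :=
  quad (invmx B) (colv q.2 - H *m colv q.1) / 2.

Let u_ge0 q : 0 <= u q. Proof. by rewrite divr_ge0// quad_inv_ge0. Qed.
Let v_ge0 q : 0 <= v q. Proof. by rewrite divr_ge0// quad_inv_ge0. Qed.

Let measurable_u : measurable_fun setT u.
Proof. by apply: measurable_funM => //; apply: measurable_quad; exact: measurable_cv2. Qed.
Let measurable_v : measurable_fun setT v.
Proof. by apply: measurable_funM => //; apply: measurable_quad; exact: measurable_res. Qed.

Let integral_u :
  (\int[distribution P (pair_RV X Z)]_q (u q)%:E = half_moment C)%E.
Proof.
have mq : measurable_fun setT (fun t : k.-tuple R => (quad (invmx C) (colv t) / 2)%:E).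
  apply/measurable_EFinP; apply: measurable_funM => //; apply: measurable_quad.
  exact: measurable_colv.
have q0 (t : k.-tuple R) : (0 <= (quad (invmx C) (colv t) / 2)%:E)%E.
  by rewrite lee_fin divr_ge0// quad_inv_ge0.
by rewrite (integral_snd_pair mq q0) (observation_density mq q0).
Qed.

Let integral_v :
  (\int[distribution P (pair_RV X Z)]_q (v q)%:E = half_moment B)%E.
Proof.
have mv : measurable_fun setT (fun q => (v q)%:E) by exact/measurable_EFinP.
have mvp : measurable_fun setT (fun q => (v q)%:E * (p q)%:E)%E.
  by apply: emeasurable_funM => //; exact/measurable_EFinP.
have mq : measurable_fun setT (half_moment_density B).
  exact: measurable_half_moment_density.
have q0 t : (0 <= half_moment_density B t)%E by exact: half_moment_density_ge0.
have mX : measurable_fun setT (fun t : n.-tuple R => (gauss_pdf GammaX (colv t))%:E).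
  by apply/measurable_EFinP/measurable_gauss_pdf; exact: measurable_colv.
have vp0 q : (0 <= (v q)%:E * (p q)%:E)%E.
  by rewrite mule_ge0// lee_fin// mulr_ge0// gauss_pdf_ge0.
have v0 q : (0 <= (v q)%:E)%E by rewrite lee_fin.
rewrite (joint_density mv v0) (fubini_tonelli1 _ mvp vp0).
transitivity (\int[lebesgue_tuple n]_x ((gauss_pdf GammaX (colv x))%:E * half_moment B))%E.
  apply: eq_integral => x _; rewrite /fubini_F.
  pose c := - (H *m colv x).
  have mc : measurable_fun setT (fun t : k.-tuple R => vtuple (colv t + c)).
    by apply: measurable_vtuple; exact: measurable_res1.
  transitivity (\int[lebesgue_tuple k]_y
      ((gauss_pdf GammaX (colv x))%:E * half_moment_density B (vtuple (colv y + c))))%E.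
    apply: eq_integral => y _; rewrite /half_moment_density vtupleK /v /p/= -!EFinM.
    by congr EFin; ring.
  have X0 : (0 <= (gauss_pdf GammaX (colv x))%:E)%E by rewrite lee_fin gauss_pdf_ge0.
  have mqc : measurable_fun setT
    (fun t : k.-tuple R => half_moment_density B (vtuple (colv t + c))).
    exact: (measurableT_comp mq mc).
  rewrite (ge0_integralZl (lebesgue_tuple k) measurableT mqc (fun y _ => q0 _) X0).
  by rewrite (integral_translate c mq q0).
have m0 : (0 <= half_moment B)%E by apply: integral_ge0 => t _; exact: q0.
have X0 (t : n.-tuple R) : (0 <= (gauss_pdf GammaX (colv t))%:E)%E.
  by rewrite lee_fin gauss_pdf_ge0.
rewrite (ge0_integralZr (lebesgue_tuple n) measurableT mX (fun x _ => X0 x) m0).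
move: (half_moment B) => M.
by rewrite (integral_gauss_pdf GX) mul1e.
Qed.

Let integrable_u : (distribution P (pair_RV X Z)).-integrable setT (EFin \o u).
Proof.
apply/integrableP; split; first exact/measurable_EFinP.
under eq_integral => q _ do rewrite /= ger0_norm//.
by rewrite integral_u; exact: half_moment_ltoo.
Qed.

Let integrable_v : (distribution P (pair_RV X Z)).-integrable setT (EFin \o v).
Proof.
apply/integrableP; split; first exact/measurable_EFinP.
under eq_integral => q _ do rewrite /= ger0_norm//.
by rewrite integral_v; exact: half_moment_ltoo.
Qed.

Lemma mutual_information_gaussian :
  mutual_information X Z = (2^-1 * (ln (\det C) - ln (\det B)))%:E.
Proof.
rewrite /mutual_information (KL_density measurable_r r_gt0 joint_density_ratio).
pose c := 2^-1 * (ln (\det C) - ln (\det B)).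
transitivity (\int[distribution P (pair_RV X Z)]_q (c%:E + ((u q)%:E - (v q)%:E)))%E.
  apply: eq_integral => q _; rewrite /r ln_div ?posrE ?gauss_pdf_gt0// !ln_gauss_pdf//.
  by rewrite -EFinB -EFinD /c /u /v; congr EFin; ring.
have ic : (distribution P (pair_RV X Z)).-integrable setT (cst c%:E).
  exact: finite_measure_integrable_cst.
rewrite (integralD measurableT ic (integrableB measurableT integrable_u integrable_v)).
rewrite (integralB measurableT integrable_u integrable_v).
rewrite integral_u integral_v (half_moment_eq Cpos Bpos).
have fm : half_moment B \is a fin_num.
  rewrite ge0_fin_numE; first exact: half_moment_ltoo.
  by apply: integral_ge0 => t _; exact: half_moment_density_ge0.
rewrite (subee fm) adde0 (integral_cst _ measurableT).
by rewrite [X in (_ * X)%E]probability_setT mule1.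
Qed.

End observation.

(** * The trace bounds *)

Theorem proposition4p2 (R : realType) (d : measure_display)
    (T : measurableType d) (P : probability T R) (n m k : nat)
    (G : 'M[R]_(m, n)) (GammaX : 'M[R]_n) (GammaYX : 'M[R]_m)
    (X : {RV P >-> n.-tuple R}) (eps Y : {RV P >-> m.-tuple R})
    (S : 'M[R]_(m, k)) (YS : {RV P >-> k.-tuple R}) :
  posdefmx GammaX -> posdefmx GammaYX ->
  normal_vec X 0 GammaX -> normal_vec eps 0 GammaYX ->
  independent_RV X eps ->
  (forall w, colv (Y w) = G *m colv (X w) + colv (eps w)) ->
  is_selection S ->
  (forall w, colv (YS w) = S^T *m colv (Y w)) ->
  let GammaY := G *m GammaX *m G^T + GammaYX in
  ((2^-1 * \tr (S^T *m (logm GammaY - logm (diag_part GammaYX)) *m S))%:E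
     <= mutual_information X YS)%E /\
  (mutual_information X YS
     <= (2^-1 * \tr (S^T *m (logm (diag_part GammaY) - logm GammaYX) *m S))%:E)%E.
Proof.
move=> GX GYX XN eN Xe YE [km [s sinj SE]] YSE GammaY.
have YSE' w : colv (YS w) = (selection_mx s)^T *m (G *m colv (X w) + colv (eps w)).
  by rewrite YSE YE SE.
rewrite (mutual_information_gaussian GX GYX XN eN Xe sinj YSE') -SE -/GammaY.
have GY : posdefmx GammaY.
  split; first by rewrite linearD/= !trmx_mul trmxK GX.1 GYX.1 mulmxA.
  move=> v v0; rewrite -/(quad _ _).
  have -> : quad GammaY v = quad (G *m GammaX *m G^T) v + quad GammaYX v.
    by rewrite /quad mulmxDr mulmxDl mxE.
  apply: ltr_wpDl; last exact: GYX.2.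
  rewrite -{1}[G]trmxK -quad_mulmx; have [->|w0] := eqVneq (G^T *m v) 0.
    by rewrite /quad mulmx0 mxE.
  exact/ltW/GX.2.
have SS : S^T *m S = 1%:M.
  apply/matrixP => i j; rewrite SE !mxE (bigD1 (s i))//= !mxE eqxx mul1r.
  rewrite big1 ?addr0 ?(inj_eq sinj)// => l li.
  by rewrite !mxE (negbTE li) mul0r.
have compress (A : 'M[R]_m) i : (S^T *m A *m S) i i = A (s i) (s i).
  have Sd : S *m delta_mx i 0 = delta_mx (s i) 0 :> 'cV_m.
    by apply/colP => l; rewrite -colE SE !mxE andbT.
  by rewrite -(quad_delta (S^T *m A *m S)) -quad_mulmx Sd quad_delta.
have Spos (A : 'M[R]_m) : posdefmx A -> posdefmx (S^T *m A *m S).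
  move=> Apos; apply: posdefmx_congr => // v /(congr1 (mulmx S^T)).
  by rewrite mulmxA SS mul1mx mulmx0.
have tr_diag (A : 'M[R]_m) : posdefmx A ->
    \tr (S^T *m logm (diag_part A) *m S) = \sum_j ln ((S^T *m A *m S) j j).
  move=> Apos; apply: eq_bigr => j _; rewrite !compress logm_diag; last first.
    move=> i; rewrite mxE -quad_delta Apos.2//.
    by apply/eqP => /colP/(_ i)/eqP; rewrite !mxE !eqxx oner_eq0.
  by rewrite !mxE eqxx mulr1n.
have tr_bounds (A : 'M[R]_m) : posdefmx A ->
    \tr (S^T *m logm A *m S) <= ln (\det (S^T *m A *m S))
      <= \tr (S^T *m logm (diag_part A) *m S).
  move=> Apos; rewrite tr_diag// mxtrace_logm_compress_le//=.
  exact/hadamard/Spos.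
have /andP[Yl Yu] := tr_bounds _ GY; have /andP[El Eu] := tr_bounds _ GYX.
have trB (A B : 'M[R]_m) : \tr (S^T *m (A - B) *m S) =
    \tr (S^T *m A *m S) - \tr (S^T *m B *m S).
  by rewrite mulmxBr mulmxBl linearB.
rewrite !lee_fin !trB; split; rewrite ler_wpM2l ?invr_ge0//; exact: lerB.
Qed.
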